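(* Let $\rho\left(\operatorname{cox}_{S^{(i)}_{p,q,r}}\right)$ be the spectral radius of the Coxeter transformation of $S^{(i)}_{p,q,r}$. Then: (1) $\displaystyle\lim_{r\to\infty}\rho\left(\operatorname{cox}_{S^{(i)}_{p,q,r}}\right)=\rho\left(F^{(i)}_{p,q}(t)\right)$ and $\rho\left(F^{(i)}_{p,q}(t)\right)$ is a Pisot number, for $i=0,1,2$. (2) $\displaystyle\lim_{p\to\infty}\rho\left(\operatorname{cox}_{S^{(i)}_{p,q,r}}\right)=\rho\left(F^{(i-1)}_{q,r}(t)\right)$ for $i=1,2,3$. (3) $\displaystyle\lim_{p,q\to\infty}\rho\left(\operatorname{cox}_{S^{(i)}_{p,q,r}}\right)=\rho\left(t^{r+2}-2t^{r+1}+1\right)$ for $i=0,1,2$. (4) $\displaystyle\lim_{q,r\to\infty}\rho\left(\operatorname{cox}_{S^{(i)}_{p,q,r}}\right)=\rho\left(t^{p}-2t^{p-1}-1\right)$ for $i=1,2,3$. (5) $\displaystyle\lim_{p,q,r\to\infty}\rho\left(\operatorname{cox}_{S^{(i)}_{p,q,r}}\right)=2$ for all $i=0,1,2,3$.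
   Context: $\mathbb N$ denotes the set of nonnegative integers. Coxeter polynomial. Let $\Gamma$ be a tree with vertices $v_1,\ldots,v_n$ and adjacency matrix $[a_{ij}]$. For $1\le i\le n$ let $\sigma_i:\mathbb R^n\to\mathbb R^n$ be the linear map with $\sigma_i(e_j)=e_j-(2\delta_{ij}-a_{ij})e_i$, where $e_1,\ldots,e_n$ is the standard basis. The Coxeter transformation is $\Phi_\Gamma=\sigma_1\sigma_2\cdots\sigma_n$, and the Coxeter polynomial is its characteristic polynomial $\operatorname{cox}_\Gamma(t)=\det(t\cdot\mathrm{id}-\Phi_\Gamma)\in\mathbb Z[t]$; it does not depend on the enumeration of the vertices. Join. The join of graphs $\Gamma_1,\ldots,\Gamma_k$ with a fixed vertex $v_j$ in each $\Gamma_j$ is the graph obtained from their disjoint union by adding a new vertex $v$ and an edge from $v$ to $v_j$ for every $j$. Dynkin diagrams. $\mathbb A_n$ is the path with vertices $1,2,\ldots,n$ ($\mathbb A_0$ is empty and contributes no branch to a join); $\operatorname{cox}_{\mathbb A_n}(t)=t^n+t^{n-1}+\cdots+t+1=\frac{t^{n+1}-1}{t-1}$. $\mathbb D_n$ is the tree with vertices $1,\ldots,n$ consisting of the path $1,2,\ldots,n-2$ together with two further vertices $n-1$ and $n$, each joined by an edge to the vertex $n-2$ (for $n=3$ this is the path $2,1,3$). The trees $S^{(i)}_{p_1,p_2,p_3}$. For $p_1,p_2,p_3\in\mathbb N$ and $i\in\{0,1,2,3\}$, $S^{(i)}_{p_1,p_2,p_3}$ is the join of the Dynkin diagrams $\mathbb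 D_{p_1},\ldots,\mathbb D_{p_i}$ and $\mathbb A_{p_{i+1}},\ldots,\mathbb A_{p_3}$ at their vertices numbered $1$. The polynomials $F^{(i)}_{p,q}$: $$F^{(0)}_{p,q}(t)=t^{p+q}-\operatorname{cox}_{\mathbb A_{p-1}}(t)\operatorname{cox}_{\mathbb A_{q-1}}(t),$$ $$F^{(1)}_{p,q}(t)=t^{p+q-2}(t-1)-\left(t^{p-2}+1\right)\operatorname{cox}_{\mathbb A_{q-1}}(t),$$ $$F^{(2)}_{p,q}(t)=t^{p+q-4}(t-1)^2-\left(t^{p-2}+1\right)\left(t^{q-2}+1\right).$$ For a monic integer polynomial $f$, $\rho(f)$ is the maximum of $|z|$ over the complex roots $z$ of $f$. A Pisot polynomial is a monic irreducible non-cyclotomic integer polynomial with only one root outside the unit circle and no roots on the unit circle; a Pisot number is a real number greater than $1$ whose minimal polynomial is a Pisot polynomial. Multiple limits are iterated limits: $\lim_{p_1,\ldots,p_m\to\infty}\alpha=\lim_{p_1\to\infty}(\cdots(\lim_{p_m\to\infty}\alpha))$.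
   Formalization: In (1) the Pisot claim omits i=0, p=q=1, where F = t^2-1 has spectral radius 1; fixed indices of D-branches are taken at least 3, and indices of A-branches occurring in F at least 1, so that D_n and cox of A_{n-1} are defined. *)

(* Defs.v *)
From HB Require Import structures.
From mathcomp Require Import all_boot all_order all_algebra all_field.
From mathcomp Require Import complex.
From mathcomp Require Import boolp classical_sets reals topology normedtype.
From mathcomp Require Import sequences.

Set Implicit Arguments.
Unset Strict Implicit.
Unset Printing Implicit Defensive.

Import Order.TTheory GRing.Theory Num.Theory.
Import ComplexField.Normc numFieldNormedType.Exports.

Local Open Scope classical_set_scope.
Local Open Scope ring_scope.

(* Column j is sigma_i(e_j) = e_j - (2 delta_ij - a_ij) e_i: matrices act on
   column vectors, so that composition of maps is the matrix product. *)
Definition reflection (n : nat) (A : 'M[int]_n) (i : 'I_n) : 'M[int]_n :=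
  \matrix_(k, j) ((k == j)%:R - (k == i)%:R * (2 * (i == j)%:R - A i j)).

Definition coxeter_transformation (n : nat) (A : 'M[int]_n) : 'M[int]_n :=
  \prod_(i < n) reflection A i.

Definition adjacency (T : finType) (e : rel T) : 'M[int]_#|T| :=
  \matrix_(i, j) (e (enum_val i) (enum_val j))%:R.

(* The vertices are numbered by [enum T]. All matrix entries are integers, so
   the characteristic polynomial is computed over [int]. *)
Definition cox (T : finType) (e : rel T) : {poly int} :=
  char_poly (coxeter_transformation (adjacency e)).

(* [base] is the vertex at which a join is formed; it is [None] only for the
   empty graph, which contributes no branch to a join. *)
Record rooted_graph := RootedGraph {
  vertex : finType;
  edge : rel vertex;
  base : option vertex }.

(* The vertex [None] is the vertex added by the join. *)
Definition join_vertex (I : finType) (G : I -> rooted_graph) : finType :=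
  option {i : I & vertex (G i)}.

Definition join_edge (I : finType) (G : I -> rooted_graph) :
    rel (join_vertex G) :=
  fun x y => match x, y with
  | None, None => false
  | None, Some u | Some u, None => base (G (tag u)) == Some (tagged u)
  | Some u, Some w => (tag u == tag w) && edge (tagged u) (tagged_as u w)
  end.
Arguments join_edge {I} G.

(* In the Dynkin diagrams the ordinal k stands for the vertex numbered k + 1;
   [insub 0%N] is the vertex numbered 1, and [None] if there are no vertices. *)
Definition dynkinA (n : nat) : rooted_graph :=
  @RootedGraph 'I_n (fun i j => (i.+1 == j :> nat) || (j.+1 == i :> nat))
    (insub 0%N).

(* Either a step of the path 1, ..., n - 2, or an edge from n - 2 to one of
   n - 1 and n. The diagram D_n is meaningful for n >= 3 only. *)
Definition dynkinD_arc (n : nat) (i j : 'I_n) : bool :=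
  ((j.+2 < n)%N && (i.+1 == j :> nat)) || ((n <= j.+2)%N && (i.+3 == n)).

Definition dynkinD (n : nat) : rooted_graph :=
  @RootedGraph 'I_n (fun i j => dynkinD_arc i j || dynkinD_arc j i)
    (insub 0%N).

Definition S_branch (i p q r : nat) (j : 'I_3) : rooted_graph :=
  let n := nth 0%N [:: p; q; r] j in
  if (j < i)%N then dynkinD n else dynkinA n.

Definition coxS (i p q r : nat) : {poly int} := cox (join_edge (S_branch i p q r)).

Definition coxA (n : nat) : {poly int} := cox (@edge (dynkinA n)).

Definition Fpoly (i p q : nat) : {poly int} :=
  match i with
  | 0%N => 'X^(p + q) - coxA (p - 1) * coxA (q - 1)
  | 1%N => 'X^(p + q - 2) * ('X - 1) - ('X^(p - 2) + 1) * coxA (q - 1)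
  | 2%N => 'X^(p + q - 4) * ('X - 1) ^+ 2 - ('X^(p - 2) + 1) * ('X^(q - 2) + 1)
  | _ => 0
  end.

(* The size n of the j-th branch (counted from 0) of S^(i), as an index of the
   limit polynomial [Fpoly]: D_n requires n >= 3, and a factor cox_{A_{n-1}}
   requires n >= 1. Every subtraction in [Fpoly] is then exact. *)
Definition admissible (i j n : nat) : Prop :=
  if (j < i)%N then (3 <= n)%N else (1 <= n)%N.

(* The set of roots of a nonzero polynomial is finite, so the supremum is a
   maximum for every nonconstant polynomial. *)
Definition rho (R : realType) (f : {poly int}) : R :=
  sup [set normc z | z in [set z : R[i] | root (map_poly intr f) z]].

Definition pisot_poly (R : realType) (f : {poly int}) : Prop :=
  [/\ f \is monic,
      irreducible_poly (map_poly intr f : {poly rat}),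
      forall n : nat, (0 < n)%N -> f <> 'Phi_n,
      exists! z : R[i], root (map_poly intr f) z /\ 1 < normc z
    & forall z : R[i], root (map_poly intr f) z -> normc z != 1].

Definition minimal_poly (R : realType) (x : R) (m : {poly rat}) : Prop :=
  [/\ m \is monic,
      root (map_poly ratr m) x
    & forall g : {poly rat}, root (map_poly ratr g) x -> m %| g].

Definition pisot_number (R : realType) (x : R) : Prop :=
  1 < x /\
  exists f : {poly int}, minimal_poly x (map_poly intr f) /\ pisot_poly R f.

(* Iterated limits, the last index going to infinity first; the inner limits
   are required to exist for all large enough values of the outer indices. *)
Definition is_lim1 (R : realType) (u : nat -> R) (l : R) : Prop :=
  u n @[n --> \oo] --> l.

Definition is_lim2 (R : realType) (u : nat -> nat -> R) (l : R) : Prop :=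
  exists2 v : nat -> R,
    \forall m \near \oo, is_lim1 (u m) (v m) & is_lim1 v l.

Definition is_lim3 (R : realType) (u : nat -> nat -> nat -> R) (l : R) : Prop :=
  exists2 v : nat -> R,
    \forall k \near \oo, is_lim2 (u k) (v k) & is_lim1 v l.

(* Main.v *)
(** On a rooted tree the equation [Phi v = z v] can be solved from
    the leaves down to the root.  For [z = x^2] outside the unit circle this
    shows that [z] is an eigenvalue of the Coxeter transformation of
    [S^(i)_(p,q,r)] iff [f(x) = 0], where [f(x) = x + 1/x - h_1 - h_2 - h_3] and
    each branch contributes [h = x (x^(2n) - s) / (x^(2n+2) - s)], with [s = 1]
    for [A_n], [s = -1] for [D_(n+2)], and [h = 1/x] (formally [s = 0]) in the
    limit of an infinite branch.  Since [1/h_(n+1) = x + 1/x - h_n], every [h]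
    sends the part of the upper half-plane outside the unit disc to the closed
    lower half-plane and decreases on [x > 1].  Hence [f] has no non-real zero
    there and increases on [x > 1]: the spectral radius is determined by the
    signs of [f], and pointwise convergence of [f] implies its convergence.

    Up to trivial factors [F^(i)_(p,q)] is the numerator of the limit of [f] as
    [r] tends to infinity, so it has a single root [rho] outside the unit circle.
    If the minimal polynomial of [rho] had a root on the unit circle it would be
    self-reciprocal, and [1/rho] would be a root of [F]; but [F < 0] on
    [(0, 1)]. *)
Require Import Defs.
From mathcomp Require Import all_boot all_order all_algebra all_field.
From mathcomp Require Import complex.
From mathcomp Require Import boolp classical_sets reals topology normedtype.
From mathcomp Require Import sequences.
From mathcomp Require Import ring lra zify.

Set Implicit Arguments.
Unset Strict Implicit.
Unset Printing Implicit Defensive.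

Import Order.TTheory GRing.Theory Num.Theory.
Import ComplexField.Normc numFieldNormedType.Exports.
Local Open Scope classical_set_scope.
Local Open Scope ring_scope.

(** * Eigenvectors of the Coxeter transformation *)

Lemma mulmx_reflection (K : fieldType) (n : nat) (A : 'M[int]_n) (i : 'I_n)
    (v : 'cV[K]_n) (k : 'I_n) :
  (map_mx intr (reflection A i) *m v) k 0 =
  v k 0 - (k == i)%:R * (2 * v i 0 - \sum_j (A i j)%:~R * v j 0).
Proof.
rewrite mxE.
transitivity (\sum_j (k == j)%:R * v j 0 - (k == i)%:R *
    (\sum_j 2 * (i == j)%:R * v j 0 - \sum_j (A i j)%:~R * v j 0)).
  rewrite -sumrB mulr_sumr -sumrB; apply: eq_bigr => j _.
  rewrite !mxE !(rmorphB, rmorphM, rmorph_nat) /=; ring.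
have sum_delta (l : 'I_n) (a : K) : \sum_j a * (l == j)%:R * v j 0 = a * v l 0.
  rewrite (bigD1 l) //= eqxx mulr1 big1 ?addr0 // => j.
  by rewrite eq_sym => /negPf ->; rewrite mulr0 mul0r.
rewrite sum_delta; congr (_ - _).
by under eq_bigr do rewrite -[_%:R]mul1r; rewrite sum_delta mul1r.
Qed.

(* The reflections are applied from the last one to the first, each one
   replacing a coordinate: the later coordinates are already the new ones. *)
Lemma mulmx_coxeter (K : fieldType) (n : nat) (A : 'M[int]_n) (v : 'cV[K]_n) i :
  (map_mx intr (coxeter_transformation A) *m v) i 0 + v i 0 =
  \sum_j (A i j)%:~R *
    (if (i < j)%N then (map_mx intr (coxeter_transformation A) *m v) j 0
     else v j 0).
Proof.
pose P s := map_mx (intr : int -> K) (\prod_(i <- s) reflection A i).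
(* Induction over increasing lists: the reflection put in front acts last, on a coordinate that
   precedes all those already replaced and is still that of [v]. *)
suff {i} partial (s : seq 'I_n) : sorted ltn (map val s) ->
    (forall k, k \notin s -> (P s *m v) k 0 = v k 0) /\
    (forall k, k \in s -> (P s *m v) k 0 + v k 0 = \sum_j (A k j)%:~R *
      (if (j \in s) && (k < j)%N then (P s *m v) j 0 else v j 0)).
  have sorted_enum : sorted ltn (map val (index_enum 'I_n)).
    by rewrite /index_enum unlock -enumT val_enum_ord iota_ltn_sorted.
  have [_ /(_ i (mem_index_enum i))] := partial _ sorted_enum.
  move=> ->; apply: eq_bigr => j _.
  by rewrite mem_index_enum.
elim: s => [|i s IH] /= s_sorted.
  by rewrite /P big_nil map_mx1 mul1mx; split.
have [out_s in_s] := IH (path_sorted s_sorted).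
have i_lt j : j \in s -> (i < j)%N.
  move=> js; have /allP lt_s := order_path_min ltn_trans s_sorted.
  by apply: (lt_s (val j)); rewrite map_f.
have iNs : i \notin s by apply/negP => /i_lt; rewrite ltnn.
have Pcons k : (P (i :: s) *m v) k 0 = (P s *m v) k 0 -
    (k == i)%:R * (2 * v i 0 - \sum_j (A i j)%:~R * (P s *m v) j 0).
  by rewrite /P big_cons map_mxM -mulmxA mulmx_reflection -/(P s) (out_s i).
have PconsN k : k != i -> (P (i :: s) *m v) k 0 = (P s *m v) k 0.
  by move=> /negPf ki; rewrite Pcons ki mul0r subr0.
split=> k; rewrite inE.
  by rewrite negb_or => /andP[ki ks]; rewrite PconsN // out_s.
have [-> _|ki /= ks] := eqVneq k i; last first.
  rewrite PconsN // in_s //; apply: eq_bigr => j _; rewrite inE.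
  have [->|ji] := eqVneq j i; last by rewrite PconsN.
  by rewrite (negPf iNs) /= ltnNge ltnW ?i_lt.
rewrite Pcons eqxx mul1r out_s // opprB addrCA.
rewrite mulr2n mulrDl mul1r; set S := \sum_j _.
transitivity S; first by rewrite opprD; ring.
apply: eq_bigr => j _; rewrite inE; have [->|ji] := eqVneq j i.
  by rewrite ltnn out_s.
case: ifP => /= [/andP[_ _]|]; first by rewrite PconsN.
by move=> jF; rewrite out_s //; apply/negP => js; rewrite js i_lt in jF.
Qed.

(** The equation at [i] involves [w] only at [i] and at later indices, so it determines [w] from the
    last coordinate downwards. *)
Lemma coxeter_unique (K : fieldType) (n : nat) (A : 'M[int]_n) (v w : 'cV[K]_n) :
  (forall i, w i 0 + v i 0 =
     \sum_j (A i j)%:~R * (if (i < j)%N then w j 0 else v j 0)) ->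
  map_mx intr (coxeter_transformation A) *m v = w.
Proof.
move=> Ew; set w' := _ *m v.
suff eq_w m (k : 'I_n) : (n - k < m)%N -> w' k 0 = w k 0.
  by apply/colP => k; apply: (eq_w (n - k).+1).
elim: m => // m IH in k *; rewrite ltnS => km.
apply: (addIr (v k 0)); rewrite Ew mulmx_coxeter; apply: eq_bigr => j _.
by case: ifP => // kj; rewrite IH //; have := ltn_ord j; lia.
Qed.

(** With image z v, the relations of [mulmx_coxeter] become a weighted adjacency equation: an edge
    has weight z towards its later vertex and 1 towards its earlier one. *)
Lemma root_coxeterP (K : fieldType) (n : nat) (A : 'M[int]_n) (z : K) :
  root (map_poly intr (char_poly (coxeter_transformation A))) z <->
  exists2 v : 'cV[K]_n, v != 0 & forall i, (z + 1) * v i 0 =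
    \sum_j (A i j)%:~R * (if (i < j)%N then z else 1) * v j 0.
Proof.
rewrite map_char_poly; set Phi := map_mx _ _.
have -> : root (char_poly Phi) z <-> exists2 v : 'cV[K]_n, v != 0 & Phi *m v = z *: v.
  (* [eigenvalue] refers to row vectors, hence the passage to the transpose. *)
  have -> : char_poly Phi = char_poly Phi^T.
    rewrite /char_poly -det_tr; congr (\det _); apply/matrixP => i j.
    by rewrite !mxE eq_sym.
  rewrite -eigenvalue_root_char; split.
    case/eigenvalueP => v vP v0; exists v^T; last first.
      by rewrite -[Phi]trmxK -trmx_mul vP linearZ.
    by apply: contra v0 => /eqP/(congr1 trmx); rewrite trmxK trmx0 => ->.
  case=> v v0 vP; apply/eigenvalueP; exists v^T.
    by rewrite -trmx_mul vP linearZ.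
  by apply: contra v0 => /eqP/(congr1 trmx); rewrite trmxK trmx0 => ->.
have scaleE (v : 'cV[K]_n) i : \sum_j (A i j)%:~R *
    (if (i < j)%N then (z *: v) j 0 else v j 0) =
    \sum_j (A i j)%:~R * (if (i < j)%N then z else 1) * v j 0.
  by apply: eq_bigr => j _; rewrite mxE; case: ifP => _; rewrite ?mulr1 ?mulrA.
split=> -[v v0 vP]; exists v => //.
  move=> i; have := mulmx_coxeter A v i.
  by rewrite -/Phi vP scaleE mxE mulrDl mul1r => ->.
apply: coxeter_unique => i.
by rewrite scaleE -vP mxE mulrDl mul1r.
Qed.

Lemma root_coxP (K : fieldType) (T : finType) (e : rel T) (z : K) :
  root (map_poly intr (cox e)) z <->
  exists2 v : T -> K, exists u, v u != 0 & forall u, (z + 1) * v u =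
    \sum_(w | e u w) (if (enum_rank u < enum_rank w)%N then z else 1) * v w.
Proof.
rewrite /cox root_coxeterP.
have sumE (v : T -> K) u : \sum_(w | e u w)
    (if (enum_rank u < enum_rank w)%N then z else 1) * v w =
    \sum_j (adjacency e (enum_rank u) j)%:~R *
    (if (enum_rank u < j)%N then z else 1) * v (enum_val j).
  rewrite big_mkcond (reindex (@enum_val T T)) /=; last first.
    by apply: onW_bij; apply: enum_val_bij.
  apply: eq_bigr => j _; rewrite mxE enum_rankK enum_valK.
  by case: (e _ _); rewrite /= ?mul1r // !mul0r.
split=> [[v v0 vP]|[v [u vu] vP]].
  exists (fun u => v (enum_rank u) 0).
    have [i vi] : exists i, v i 0 != 0.
      apply/existsP; apply: contraR v0 => /existsPn v0; apply/eqP/colP => i.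
      by rewrite mxE; apply/eqP; have := v0 i; rewrite negbK.
    by exists (enum_val i); rewrite enum_valK.
  by move=> u; rewrite sumE vP; apply: eq_bigr => j _; rewrite enum_valK.
exists (\col_i v (enum_val i)).
  apply: contra vu => /eqP/colP/(_ (enum_rank u)).
  by rewrite !mxE enum_rankK => ->.
move=> i; rewrite mxE vP sumE enum_valK.
by apply: eq_bigr => j _; rewrite !mxE.
Qed.

(** * Eigenvectors on rooted trees and joins *)

(** The depth excludes cycles of parents and is the measure for inductions both from the leaves and
    from the root. *)
Record rooted_tree (T : finType) (e : rel T) (par : T -> option T) (d : T -> nat) :
    Prop := RootedTree {
  tree_edge : forall u w, e u w = (par u == Some w) || (par w == Some u);
  tree_root_depth : forall u, par u = None -> d u = 0%N;
  tree_depth : forall u w, par u = Some w -> d u = (d w).+1 }.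

(* [H u] is the ratio v_u / v_(par u), up to the weight of the edge, in a
   solution v of the eigenvector equation at u and at the descendants of u. *)
Definition gain_eq (K : fieldType) (t : K) (T : finType) (par : T -> option T)
    (H : T -> K) (u : T) : Prop :=
  H u * (t + 1 - t * \sum_(w | par w == Some u) H w) = 1.

Section TreeKernel.
Variables (K : fieldType) (t : K) (T : finType) (e : rel T).
Variables (par : T -> option T) (d : T -> nat) (r : T).
Hypothesis treeT : rooted_tree e par d.
Hypothesis par_root : forall u, (par u == None) = (u == r).

Lemma sum_tree_edge (F : T -> K) u :
  \sum_(w | e u w) F w =
  (if par u is Some p then F p else 0) + \sum_(w | par w == Some u) F w.
Proof.
rewrite (bigID (fun w => par w == Some u)) /= addrC; congr (_ + _).
  have -> : \sum_(w | e u w && (par w != Some u)) F w =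
      \sum_(w | par u == Some w) F w.
    apply: eq_bigl => w; rewrite (tree_edge treeT) andb_orl andbN orbF.
    case: eqP => //= uw; apply/eqP => wu.
    by have := tree_depth treeT uw; rewrite (tree_depth treeT wu); lia.
  case: (par u) => [p|]; last by rewrite big_pred0.
  by rewrite (big_pred1 p) // => w; rewrite eq_sym.
by apply: eq_bigl => w; rewrite (tree_edge treeT) andb_orl andbb orb_idl // => /andP[].
Qed.

Variables (c : T -> T -> K) (H : T -> K).
Hypothesis c_edge : forall u w, e u w -> c u w * c w u = t.
Hypothesis H_gain : forall u, u != r -> gain_eq t par H u.

(** Induction from the deepest vertices upwards: once the children are expressed through [v u], the
    gain equation solves the equation at [u] for [v u]. *)
Lemma tree_kernel_ratio (v : T -> K) u p :
  (forall u, (t + 1) * v u = \sum_(w | e u w) c u w * v w) ->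
  par u = Some p -> v u = H u * c u p * v p.
Proof.
move=> vP; have [D dD] : exists D, forall u, (d u <= D)%N.
  by exists (\max_u d u)%N => w; apply: leq_bigmax.
have [m] := ubnP (D - d u); elim: m u p => // m IH u p um up.
have child w : par w == Some u -> c u w * v w = t * H w * v u.
  move=> /eqP wu; rewrite (IH w u) //; last first.
    by have := dD w; rewrite (tree_depth treeT wu) in um *; lia.
  have /c_edge : e w u by rewrite (tree_edge treeT) wu eqxx.
  by move=> <-; ring.
have uNr : u != r by rewrite -par_root up.
have := vP u; rewrite sum_tree_edge up (eq_bigr _ child) -mulr_suml -mulr_sumr.
move=> vu; rewrite -[LHS]mul1r -(H_gain uNr).
by rewrite -!mulrA mulrBl vu addrK mulrA.
Qed.

(** The ratios determine [v] from its value at the root, and only the equation there remains as a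
    condition. The weights enter through the products [c u w * c w u = t] alone, so the numbering of
    the vertices drops out. *)
Lemma tree_kernelP :
  (exists2 v : T -> K, exists u, v u != 0 &
     forall u, (t + 1) * v u = \sum_(w | e u w) c u w * v w) <->
  t + 1 - t * \sum_(w | par w == Some r) H w = 0.
Proof.
have parr : par r = None by apply/eqP; rewrite par_root.
have root_sum (v : T -> K) :
    (forall w p, par w = Some p -> v w = H w * c w p * v p) -> forall u,
    \sum_(w | par w == Some u) c u w * v w =
    t * (\sum_(w | par w == Some u) H w) * v u.
  move=> vH u; rewrite mulr_sumr mulr_suml; apply: eq_bigr => w /eqP wu.
  rewrite (vH _ _ wu).
  have /c_edge <- : e w u by rewrite (tree_edge treeT) wu eqxx.
  by ring.
split=> [[v [u vu] vP]|root_eq].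
  have ratio w p := @tree_kernel_ratio v w p vP.
  have v_root : (t + 1 - t * \sum_(w | par w == Some r) H w) * v r = 0.
    by rewrite mulrBl vP sum_tree_edge parr add0r root_sum // subrr.
  (* If [v] vanished at the root, the ratios would carry the zero down to every vertex. *)
  have [vr|vr] := eqVneq (v r) 0; last first.
    by apply/eqP; have /eqP := v_root; rewrite mulf_eq0 (negPf vr) orbF.
  suff v0 m w : (d w < m)%N -> v w = 0 by rewrite (v0 (d u).+1) ?eqxx in vu.
  elim: m w => // m IH w wm; case wp: (par w) => [p|].
    rewrite (ratio _ _ wp) (IH p) ?mulr0 //.
    by have := tree_depth treeT wp; lia.
  by move/eqP: wp; rewrite par_root => /eqP ->.
(* The depth serves as fuel: [v u] is the product of the ratios along the path from the root, where
   the value is 1. *)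
pose fix vf m u {struct m} := if m is m'.+1 then
  (if par u is Some p then H u * c u p * vf m' p else 1) else 1.
pose v u := vf (d u) u.
have v_ratio u p : par u = Some p -> v u = H u * c u p * v p.
  by move=> up; rewrite /v (tree_depth treeT up) /= up.
have vr : v r = 1 by rewrite /v (tree_root_depth treeT parr).
exists v; first by exists r; rewrite vr oner_eq0.
move=> u; rewrite sum_tree_edge root_sum //.
case up: (par u) => [p|].
  have uNr : u != r by rewrite -par_root up.
  apply/eqP; rewrite -subr_eq -mulrBl (v_ratio _ _ up).
  rewrite !mulrA [_ * H u]mulrC (H_gain uNr) mul1r eqxx //.
move/eqP: up; rewrite par_root => /eqP ->.
by rewrite vr !mulr1 add0r; apply/eqP; rewrite -subr_eq0 root_eq.
Qed.
End TreeKernel.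

(** The gain equation is required at the base as well: in a join the base has a parent, the new
    vertex. *)
Record branch (K : fieldType) (t : K) (G : rooted_graph) := Branch {
  parent : vertex G -> option (vertex G);
  depth : vertex G -> nat;
  gain : vertex G -> K;
  branch_tree : rooted_tree (@edge G) parent depth;
  branch_base : forall u, (parent u == None) = (base G == Some u);
  branch_gain_eq : forall u, gain_eq t parent gain u }.

(** By [branch_base] the sum has at most one term; it is 0 for the empty graph. *)
Definition branch_gain (K : fieldType) (t : K) (G : rooted_graph)
    (B : branch t G) : K :=
  \sum_(u | parent B u == None) gain B u.

Section Join.
Variables (K : fieldType) (t : K) (I : finType) (G : I -> rooted_graph).
Variable B : forall i, branch t (G i).

Definition join_parent (x : join_vertex G) : option (join_vertex G) :=
  if x is Some u then
    Some (omap (fun m => Tagged (fun i => vertex (G i)) m)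
               (parent (B (tag u)) (tagged u)))
  else None.

Definition join_depth (x : join_vertex G) : nat :=
  if x is Some u then (depth (B (tag u)) (tagged u)).+1 else 0%N.

Definition join_gain (x : join_vertex G) : K :=
  if x is Some u then gain (B (tag u)) (tagged u) else 0.

Local Notation jv i m := (Some (existT (fun i => Finite.sort (vertex (G i))) i m)).

Lemma join_parent_Some i (m k : vertex (G i)) :
  (join_parent (jv i m) == Some (jv i k)) =
  (parent (B i) m == Some k).
Proof.
rewrite /join_parent /=; case: (parent _ m) => [p|] //=.
by rewrite !(inj_eq Some_inj) eq_Tagged.
Qed.

Lemma join_parent_tag u w :
  join_parent (Some u) = Some (Some w) -> tag u = tag w.
Proof. by rewrite /join_parent; case: (parent _ _) => [p|] //= [] <-. Qed.

Lemma join_tree : rooted_tree (join_edge G) join_parent join_depth.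
Proof.
split=> [[[i m]|] [[j k]|]|[]|[[i m]|] [[j k]|]] //.
- rewrite [LHS]/=; have [ij|Nij] := eqVneq i j.
    case: j / ij k => k; rewrite tagged_asE !join_parent_Some.
    exact: tree_edge (branch_tree (B i)) m k.
  apply/esym/negbTE; rewrite negb_or.
  by apply/andP; split; apply: contra Nij => /eqP/join_parent_tag /= ->.
- by rewrite orbF /= -(branch_base (B i)); case: (parent _ m).
- by rewrite /= -(branch_base (B j)); case: (parent _ k).
- move=> mk; have /= ij := join_parent_tag mk; case: j / ij k mk => k /eqP.
  by rewrite join_parent_Some => /eqP /(tree_depth (branch_tree (B i))) /= ->.
- rewrite /=; case mp: (parent _ m) => [p|] //= _.
  by rewrite (tree_root_depth (branch_tree (B i)) mp).
Qed.

Arguments join_parent : simpl never.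

Lemma join_parent_None x : (join_parent x == None) = (x == None).
Proof. by case: x. Qed.

Lemma sum_option_sig (P : pred {i : I & vertex (G i)})
    (Q : pred (join_vertex G)) (F : join_vertex G -> K) :
  Q None = false -> (forall u, Q (Some u) = P u) ->
  \sum_(x | Q x) F x = \sum_(u | P u) F (Some u).
Proof.
move=> QN QS; rewrite (reindex_omap Some id) /=; last first.
  by case=> //; rewrite QN.
by apply: eq_bigl => u; rewrite QS eqxx andbT.
Qed.

Lemma join_gain_eq x : x != None -> gain_eq t join_parent join_gain x.
Proof.
case: x => [[i m]|] // _; have := branch_gain_eq (B i) m.
rewrite /gain_eq => gain_m; rewrite -[RHS]gain_m /=; congr (_ * (_ - _ * _)).
rewrite (@sum_option_sig (fun u => (tag u == i) &&
  (join_parent (Some u) == Some (jv i m)))) //=; last first.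
  move=> u; rewrite andb_idl // => /eqP/join_parent_tag /= ->; exact: eqxx.
rewrite -(@sig_big_dep _ _ _ _ _ (pred1 i) (fun j k =>
  join_parent (jv j k) == Some (jv i m))
  (fun j k => gain (B j) k)) /=.
by rewrite big_pred1_eq; apply: eq_bigl => k; rewrite -join_parent_Some.
Qed.

Lemma root_cox_join :
  root (map_poly intr (cox (join_edge G))) t <->
  t + 1 - t * \sum_i branch_gain (B i) = 0.
Proof.
pose c (x y : join_vertex G) := if (enum_rank x < enum_rank y)%N then t else 1.
have c_edge x y : join_edge G x y -> c x y * c y x = t.
  move=> xy; rewrite /c; case: ltngtP; rewrite ?mulr1 ?mul1r //.
  move/val_inj/enum_rank_inj => eq_xy; move: xy; rewrite eq_xy.
  rewrite (tree_edge join_tree) orbb => /eqP yy.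
  by have := tree_depth join_tree yy; lia.
rewrite root_coxP (tree_kernelP join_tree join_parent_None c_edge join_gain_eq).
rewrite (@sum_option_sig (fun u => parent (B (tag u)) (tagged u) == None)) //=.
  by rewrite -(@sig_big_dep _ _ _ _ _ xpredT (fun j k => parent (B j) k == None)
    (fun j k => gain (B j) k)).
by move=> u; rewrite /join_parent; case: (parent _ _).
Qed.
End Join.

(** * Dynkin branches *)

(* With [s = 1], [s = -1] and [s = 0] this is the gain of the branches A_k,
   D_(k+2) and of an infinite path, respectively. *)
Definition ratio_gain (K : fieldType) (s : int) (k : nat) (t : K) : K :=
  (t ^+ k - s%:~R) / (t ^+ k.+1 - s%:~R).

(** This is the gain equation of a vertex with a single child, that is, of a branch prolonged by one
    vertex at its base. *)
Lemma ratio_gain_step (K : fieldType) (s : int) (k : nat) (t : K) :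
  (forall j, t ^+ j.+1 != s%:~R) ->
  ratio_gain s k.+1 t * (t + 1 - t * ratio_gain s k t) = 1.
Proof.
move=> tNs; have n0 j : t ^+ j.+1 - s%:~R != 0 by rewrite subr_eq0.
have := n0 k; have := n0 k.+1; rewrite /ratio_gain !exprS.
by move: s%:~R (t ^+ k) => b a n1 n2; field; rewrite n1 n2.
Qed.

Definition ord_parent (n : nat) (f : nat -> nat) (u : 'I_n) : option 'I_n :=
  if u == 0%N :> nat then None else insub (f u).

Lemma ord_parentE n f (u w : 'I_n) :
  (ord_parent f u == Some w) = (u != 0%N :> nat) && (f u == w).
Proof.
rewrite /ord_parent; case: (_ == 0%N) => //=; have [fu|fu] := ltnP (f u) n.
  by rewrite (insubT (fun m => m < n)%N fu) (inj_eq Some_inj) -val_eqE.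
rewrite (insubF _ (negbTE _)) -?leqNgt //; apply/esym/negbTE; have := ltn_ord w; lia.
Qed.

Lemma ord_parent_None n (f : nat -> nat) (u : 'I_n) : (forall u : 'I_n, f u < n)%N ->
  (ord_parent f u == None) = (u == 0%N :> nat).
Proof.
rewrite /ord_parent => fn; case: (_ == 0%N) => //.
by rewrite (insubT (fun m => m < n)%N (fn u)).
Qed.

Lemma insub0E n (u : 'I_n) : (insub 0%N == Some u) = (u == 0%N :> nat).
Proof.
have n0 : (0 < n)%N by have := ltn_ord u; lia.
by rewrite (insubT (fun m => m < n)%N n0) (inj_eq Some_inj) eq_sym -val_eqE.
Qed.

Section Dynkin.
Variables (K : fieldType) (t : K).

Lemma sum_ord_eq (n m : nat) (P : pred 'I_n) (F : nat -> K) :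
  (forall u : 'I_n, P u = (u == m :> nat)) ->
  \sum_(u < n | P u) F u = if (m < n)%N then F m else 0.
Proof. by move=> PE; rewrite (eq_bigl _ _ PE) big_ord1_eq. Qed.

Section A.
Variable n : nat.
Hypothesis tN1 : forall k, t ^+ k.+1 != 1.

Definition dynkinA_gain (u : 'I_n) : K := ratio_gain 1 (n - u) t.

Lemma dynkinA_tree :
  @rooted_tree 'I_n (@edge (dynkinA n)) (ord_parent predn) (@nat_of_ord n).
Proof.
split=> [u w|u|u w].
- by rewrite !ord_parentE /= orbC; congr (_ || _); lia.
- move/eqP; rewrite ord_parent_None; first by move/eqP.
  by move=> {}u; have := ltn_ord u; lia.
- by move/eqP; rewrite ord_parentE => /andP[]; lia.
Qed.

Lemma dynkinA_gain_eq u : gain_eq t (ord_parent predn) dynkinA_gain u.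
Proof.
rewrite /gain_eq (@sum_ord_eq n u.+1 _ (fun u => ratio_gain 1 (n - u) t)); last first.
  by move=> w; rewrite ord_parentE; lia.
rewrite /dynkinA_gain -[RHS](@ratio_gain_step _ 1 (n - u.+1) t) //.
rewrite -subSn ?ltn_ord // subSS.
case: ltnP => // nu; have -> : (n - u.+1 = 0)%N by lia.
by rewrite /ratio_gain expr0 subrr mul0r.
Qed.

Lemma dynkinA_base (u : 'I_n) :
  (ord_parent predn u == None) = (base (dynkinA n) == Some u).
Proof.
rewrite ord_parent_None; first by rewrite insub0E.
by move=> {}u; have := ltn_ord u; lia.
Qed.

Definition dynkinA_branch : branch t (dynkinA n) :=
  @Branch K t (dynkinA n) (ord_parent predn) (@nat_of_ord n) dynkinA_gain
    dynkinA_tree dynkinA_base dynkinA_gain_eq.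

Lemma branch_gain_dynkinA : branch_gain dynkinA_branch = ratio_gain 1 n t.
Proof.
rewrite /branch_gain /= (@sum_ord_eq n 0%N _ (fun u => ratio_gain 1 (n - u) t)).
  case: n => [|m]; rewrite ?subn0 //.
  by rewrite /ratio_gain expr0 subrr mul0r.
by move=> u; rewrite dynkinA_base insub0E.
Qed.
End A.

Section D.
Variable n : nat.
Hypothesis n_ge3 : (3 <= n)%N.
Hypothesis tNN1 : forall k, t ^+ k.+1 != -1.

(** The ordinals n - 2 and n - 1 are the two leaves at the fork n - 3; only the latter is not a
    child of its predecessor. *)
Definition dynkinD_parent (m : nat) : nat := if m.+1 == n then (n - 3)%N else m.-1.

Definition dynkinD_depth (u : 'I_n) : nat := if u.+1 == n then u.-1 else u.

(** Each leaf has gain 1/(t + 1). Together they feed 2/(t + 1) into the fork, which is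
    [ratio_gain (-1) 0 t]; this is why D_n follows the recursion of a path with the sign -1 and
    length n - 2. *)
Definition dynkinD_ratio (m : nat) : K :=
  if (m.+2 < n)%N then ratio_gain (-1) (n - 2 - m) t else (t + 1)^-1.

Lemma dynkinD_parent_lt (u : 'I_n) : (dynkinD_parent u < n)%N.
Proof. by have := ltn_ord u; rewrite /dynkinD_parent; case: ifP => ?; lia. Qed.

Lemma dynkinD_tree : @rooted_tree 'I_n (@edge (dynkinD n))
  (ord_parent dynkinD_parent) dynkinD_depth.
Proof.
split=> [u w|u|u w].
- have := ltn_ord u; have := ltn_ord w.
  rewrite !ord_parentE /= /dynkinD_arc /dynkinD_parent.
  by case: ifP => ?; case: ifP => ?; lia.
- move/eqP; rewrite ord_parent_None; last exact: dynkinD_parent_lt.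
  by rewrite /dynkinD_depth => /eqP ->; case: ifP.
- have := ltn_ord u; have := ltn_ord w.
  move=> wn un /eqP; rewrite ord_parentE => /andP[].
  by rewrite /dynkinD_parent /dynkinD_depth; case: ifP => ?; case: ifP => ?; lia.
Qed.

Lemma dynkinD_gain_eq (u : 'I_n) :
  gain_eq t (ord_parent dynkinD_parent) (fun u : 'I_n => dynkinD_ratio u) u.
Proof.
have un := ltn_ord u; have t1 : t + 1 != 0.
  by have := tNN1 0; rewrite expr1 -subr_eq0 opprK.
rewrite /gain_eq; have [u_path|u_leaf] := ltnP u.+2 n; last first.
  rewrite big_pred0 ?mulr0 ?subr0.
    by rewrite /dynkinD_ratio ltnNge u_leaf mulVf.
  move=> w; rewrite ord_parentE /dynkinD_parent; have := ltn_ord w.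
  by case: ifP => ?; lia.
have step := @ratio_gain_step _ (-1) (n - 2 - u.+1) t tNN1.
rewrite -subSn in step; last by lia.
rewrite {1}/dynkinD_ratio u_path -[RHS]step subSS; congr (_ * (_ - _ * _)).
have [u_fork|u_Nfork] := eqVneq u.+3 n; last first.
  rewrite (@sum_ord_eq n u.+1 _ dynkinD_ratio); last first.
    by move=> w; rewrite ord_parentE /dynkinD_parent; case: ifP => ?; lia.
  by rewrite /dynkinD_ratio !ifT //; lia.
rewrite (bigID (fun w : 'I_n => w == u.+1 :> nat)) /=.
rewrite (@sum_ord_eq n u.+1 _ dynkinD_ratio); last first.
  by move=> w; rewrite ord_parentE /dynkinD_parent; case: ifP => ?; lia.
rewrite (@sum_ord_eq n u.+2 _ dynkinD_ratio); last first.
  move=> w; have := ltn_ord w; rewrite ord_parentE /dynkinD_parent.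
  by case: ifP => ?; lia.
rewrite !ifT; try lia.
rewrite /dynkinD_ratio !ifF; try lia.
have -> : (n - 2 - u.+1 = 0)%N by lia.
by rewrite /ratio_gain expr0 expr1 !rmorphN1 opprK; field.
Qed.

Lemma dynkinD_base (u : 'I_n) :
  (ord_parent dynkinD_parent u == None) = (base (dynkinD n) == Some u).
Proof. by rewrite ord_parent_None ?insub0E //; apply: dynkinD_parent_lt. Qed.

Definition dynkinD_branch : branch t (dynkinD n) :=
  @Branch K t (dynkinD n) (ord_parent dynkinD_parent) dynkinD_depth
    (fun u => dynkinD_ratio u) dynkinD_tree dynkinD_base dynkinD_gain_eq.

Lemma branch_gain_dynkinD :
  branch_gain dynkinD_branch = ratio_gain (-1) (n - 2) t.
Proof.
rewrite /branch_gain /= (@sum_ord_eq n 0%N _ dynkinD_ratio).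
  by rewrite /dynkinD_ratio !ifT ?subn0 //; lia.
by move=> u; rewrite dynkinD_base insub0E.
Qed.
End D.
End Dynkin.

(* Sign and length in [ratio_gain] of the j-th branch, with n vertices, of S^(i). *)
Definition branch_sign (i j : nat) : int := if (j < i)%N then -1 else 1.
Definition branch_length (i j n : nat) : nat := if (j < i)%N then (n - 2)%N else n.

Lemma root_coxS (K : fieldType) (t : K) (i p q r : nat) :
  (forall k, t ^+ k.+1 != 1) -> (forall k, t ^+ k.+1 != -1) ->
  (0 < i -> 3 <= p)%N -> (1 < i -> 3 <= q)%N -> (2 < i -> 3 <= r)%N ->
  root (map_poly intr (coxS i p q r)) t <->
  t + 1 - t * (ratio_gain (branch_sign i 0) (branch_length i 0 p) t +
               ratio_gain (branch_sign i 1) (branch_length i 1 q) t +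
               ratio_gain (branch_sign i 2) (branch_length i 2 r) t) = 0.
Proof.
move=> tN1 tNN1 p3 q3 r3.
have B (j : 'I_3) : {B : branch t (S_branch i p q r j) | branch_gain B =
    ratio_gain (branch_sign i j) (branch_length i j (nth 0%N [:: p; q; r] j)) t}.
  rewrite /S_branch /branch_sign /branch_length; case: ltnP => ji.
    have n3 : (3 <= nth 0%N [:: p; q; r] j)%N.
      by case: j ji => [[|[|[|j]]] /= jlt ji]; rewrite ?p3 ?q3 ?r3.
    exists (dynkinD_branch n3 tNN1); exact: branch_gain_dynkinD.
  exists (dynkinA_branch _ tN1); exact: branch_gain_dynkinA.
rewrite /coxS (root_cox_join (fun j => sval (B j))).
under eq_bigr do rewrite (svalP (B _)).
by rewrite !big_ord_recr big_ord0 /= add0r.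
Qed.

(** * The Coxeter polynomial of A_n *)

Lemma enum_rank_lt (n : nat) (u w : 'I_n) :
  (enum_rank u < enum_rank w)%N = (u < w)%N.
Proof. by rewrite !enum_rank_ord. Qed.

(** At a root of unity the denominators of the gains vanish, so an eigenvector is written down
    directly. The sequence [f] satisfies the recurrence of an infinite path and vanishes just past
    both ends: formally at -1, and at n because [z ^+ n.+1 = 1]. *)
Lemma root_coxA (K : fieldType) (n : nat) (z : K) :
  z != 1 -> z ^+ n.+1 = 1 -> (0 < n)%N -> root (map_poly intr (coxA n)) z.
Proof.
move=> z1 zn n_gt0; apply/root_coxP.
have z0 : z != 0.
  by apply/eqP => z0; move/eqP: zn; rewrite z0 exprS mul0r eq_sym oner_eq0.
pose f m : K := (z ^+ m.+1 - 1) / z ^+ m.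
have f0 : f 0%N != 0 by rewrite /f expr0 divr1 expr1 subr_eq0.
exists (fun u : 'I_n => f u); first by exists (Ordinal n_gt0).
move=> u; rewrite (sum_tree_edge (dynkinA_tree n)).
set c := fun w : 'I_n => if (enum_rank u < enum_rank w)%N then z else 1.
have -> : \sum_(w | ord_parent predn w == Some u) c w * f w =
    z * (if (u.+1 < n)%N then f u.+1 else 0).
  rewrite -(@sum_ord_eq _ n u.+1 _ f (fun w => erefl)) mulr_sumr.
  apply: eq_big => [w|w]; first by rewrite ord_parentE; lia.
  by rewrite ord_parentE /c enum_rank_lt => /andP[w0 wu]; rewrite ifT //; lia.
have -> : (if ord_parent predn u is Some p then c p * f p else 0) =
    if val u is m.+1 then f m else 0.
  rewrite /ord_parent; case: u @c => [[|m] mn] c //=.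
  have mn' := ltnW mn; rewrite (insubT (fun k => k < n)%N mn') /=.
  by rewrite /c enum_rank_lt /= ltnNge leqnSn /= mul1r.
have -> : (if (u.+1 < n)%N then f u.+1 else 0) = f u.+1.
  case: ltnP => // nu; have -> : u.+1 = n by have := ltn_ord u; lia.
  by rewrite /f zn subrr mul0r.
case: u @c => [[|m] mn] c; rewrite /f /= ?expr0 !exprS.
  by rewrite expr0; field; rewrite z0 oner_eq0.
have : z ^+ m != 0 by rewrite expf_neq0.
by move: (z ^+ m) => a a0; field; rewrite a0 z0.
Qed.

(** The n roots of unity of order dividing n + 1 and different from 1 are distinct roots of a monic
    polynomial of degree n, so they are all its roots. *)
Lemma coxA_geometric (n : nat) : ('X - 1) * coxA n = 'X^(n.+1) - 1.
Proof.
apply: (map_inj_poly (intr_inj : injective (intr : int -> algC)) (rmorph0 _)).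
rewrite rmorphM !rmorphB /= map_polyXn map_polyX rmorph1.
have [z zP] := C_prim_root_exists (ltn0Sn n).
have monicA : map_poly (intr : int -> algC) (coxA n) \is monic.
  exact: monic_map (char_poly_monic _).
have sizeA : size (map_poly (intr : int -> algC) (coxA n)) = n.+1.
  by rewrite size_map_inj_poly ?rmorph0 // ?size_char_poly ?card_ord //; exact: intr_inj.
rewrite -(factor_Xn_sub_1 zP) big_nat_recl // expr0; congr (_ * _).
rewrite (@all_roots_prod_XsubC _ (map_poly intr (coxA n))
  [seq z ^+ i.+1 | i <- index_iota 0 n]).
- by rewrite (monicP monicA) scale1r big_map.
- by rewrite sizeA size_map size_iota subn0.
- apply/allP => _ /mapP[k + ->]; rewrite mem_index_iota => /andP[_ k_n].
  have zk : (z ^+ k.+1) ^+ n.+1 = 1.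
    by rewrite exprAC (prim_expr_order zP) expr1n.
  by apply: root_coxA zk _; [rewrite -(prim_order_dvd zP) gtnNdvd | lia].
- rewrite uniq_rootsE map_inj_in_uniq ?iota_uniq // => i j.
  rewrite !mem_index_iota => /= i_n j_n /eqP.
  by rewrite (eq_prim_root_expr zP) !modn_small // => /eqP[].
Qed.

(** * Gains outside the unit circle *)

Definition good_sign (s : int) : bool := s \in [:: 1; -1; 0].

(* The gain of a branch for the symmetrised eigenvector equation, in terms of
   a square root x of the eigenvalue: the adjacency eigenvalue is x + 1/x. *)
Definition sym_gain (K : fieldType) (s : int) (n : nat) (x : K) : K :=
  x * ratio_gain s n (x ^+ 2).

Lemma sym_gain_step (K : fieldType) (s : int) (n : nat) (x : K) : x != 0 ->
  (forall j, (x ^+ 2) ^+ j.+1 != s%:~R) ->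
  sym_gain s n.+1 x = (x + x^-1 - sym_gain s n x)^-1.
Proof.
move=> x0 xNs; have step := ratio_gain_step n xNs; rewrite /sym_gain.
set A := (X in _ * X = 1) in step.
have A0 : A != 0 by apply: contra_eqN step => /eqP ->; rewrite mulr0 eq_sym oner_eq0.
have -> : x + x^-1 - x * ratio_gain s n (x ^+ 2) = A / x by rewrite /A; field.
by rewrite invf_div; apply: (mulIf A0); rewrite -mulrA step mulr1 divfK.
Qed.

Lemma sym_gain0 (K : fieldType) (s : int) (x : K) : good_sign s -> x != 0 ->
  (forall j, (x ^+ 2) ^+ j.+1 != s%:~R) ->
  sym_gain s 0 x = if s == 1 then 0 else if s == 0 then x^-1 else 2 / (x + x^-1).
Proof.
rewrite /good_sign !inE => s_good x0 /(_ 0%N); rewrite expr1 => xNs.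
rewrite /sym_gain /ratio_gain expr0 expr1.
case/or3P: s_good xNs => /eqP -> /=.
- by rewrite subrr mul0r mulr0.
- rewrite rmorphN1 => x2; have x21 : x ^+ 2 + 1 != 0 by rewrite -subr_eq0 opprK in x2.
  rewrite !opprK; field; rewrite x0 x21 //.
- by rewrite !subr0 => x2; field.
Qed.

(** * Gains on the real half-line beyond 1 *)

Section RealGain.
Variable R : realType.
Implicit Types (s : int) (n : nat) (x y : R).

Lemma exp_gt_sign s x j : good_sign s -> 1 < x -> s%:~R < x ^+ j.+1.
Proof.
move=> s_good x1; apply: le_lt_trans (_ : 1 < _); last by rewrite exprn_egt1.
rewrite -[leRHS]mulr1z ler_int; move: s_good.
by rewrite /good_sign !inE => /or3P[] /eqP ->.
Qed.

Lemma sqr_exp_neq s x : good_sign s -> 1 < x ->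
  forall j, (x ^+ 2) ^+ j.+1 != s%:~R.
Proof. by move=> s_good x1 j; rewrite gt_eqF // exp_gt_sign // exprn_egt1. Qed.

Lemma addV_gt2 x : 1 < x -> 2 < x + x^-1.
Proof.
move=> x1; have x0 : 0 < x by apply: lt_trans x1.
rewrite -subr_gt0; have -> : x + x^-1 - 2 = (x - 1) ^+ 2 / x by field; rewrite gt_eqF.
by rewrite divr_gt0 // exprn_gt0 // subr_gt0.
Qed.

Lemma addV_mono x y : 1 < x -> x < y -> x + x^-1 < y + y^-1.
Proof.
move=> x1 xy; have x0 : 0 < x by apply: lt_trans x1.
have y0 : 0 < y by apply: lt_trans xy.
rewrite -subr_gt0.
have -> : y + y^-1 - (x + x^-1) = (y - x) * (x * y - 1) / (x * y).
  by field; rewrite !gt_eqF.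
rewrite divr_gt0 ?mulr_gt0 ?subr_gt0 //.
by rewrite -[1]mulr1 ltr_pM // (lt_trans x1 xy).
Qed.

(** As x + 1/x > 2, a gain below 1 leaves a denominator above 1 in the recursion, so the next gain
    lies between 0 and 1 again. *)
Lemma sym_gain_bounds s n x : good_sign s -> 1 < x ->
  0 <= sym_gain s n x < 1.
Proof.
move=> s_good x1; have x0 : 0 < x by apply: lt_trans x1.
have s2 := addV_gt2 x1; have xNs := sqr_exp_neq s_good x1.
have xn0 : x != 0 by rewrite gt_eqF.
elim: n => [|n /andP[h0 h1]]; last first.
  rewrite sym_gain_step //.
  rewrite invr_ge0 invf_lt1; lra.
rewrite sym_gain0 //.
case: (s == 1); first by rewrite lexx ltr01.
case: (s == 0); first by rewrite invr_ge0 ltW // invf_lt1.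
rewrite divr_ge0 ?ltr_pdivrMr //=; lra.
Qed.

(** In the recursion the denominator x + 1/x - h_n increases with x when h_n does not increase;
    inversion reverses the order. *)
Lemma sym_gain_anti s n x y : good_sign s -> 1 < x -> x < y ->
  sym_gain s n y <= sym_gain s n x.
Proof.
move=> s_good x1 xy; have x0 : 0 < x by apply: lt_trans x1.
have y1 := lt_trans x1 xy; have y0 : 0 < y by apply: lt_trans xy.
have sx := addV_gt2 x1; have sxy := addV_mono x1 xy.
have xNs := sqr_exp_neq s_good x1; have yNs := sqr_exp_neq s_good y1.
have xn0 : x != 0 by rewrite gt_eqF.
have yn0 : y != 0 by rewrite gt_eqF.
elim: n => [|n IH].
  rewrite !sym_gain0 //; case: (s == 1) => //.
  case: (s == 0); first by rewrite lef_pV2 ?posrE // ltW.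
  by rewrite ler_pM2l // lef_pV2 ?posrE; lra.
rewrite !sym_gain_step //.
have /andP[hx0 hx1] := sym_gain_bounds n s_good x1.
have /andP[hy0 hy1] := sym_gain_bounds n s_good y1.
rewrite lef_pV2 ?posrE; lra.
Qed.

(** The value 1/x is a fixed point of h -> 1/(x + 1/x - h). Since the denominators are at least 1,
    each step shrinks the distance to it by the factor 1/x or better. *)
Lemma sym_gain_dist s n x : good_sign s -> 1 < x ->
  `|sym_gain s n x - x^-1| <= x^-1 ^+ n.
Proof.
move=> s_good x1; have x0 : 0 < x by apply: lt_trans x1.
have xV1 : x^-1 < 1 by rewrite invf_lt1.
have xV0 : 0 < x^-1 by rewrite invr_gt0.
elim: n => [|n IH].
  have /andP[] := sym_gain_bounds 0 s_good x1.
  by rewrite expr0 ler_norml => h0 h1; apply/andP; split; lra.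
have /andP[h0 h1] := sym_gain_bounds n s_good x1.
have s2 := addV_gt2 x1.
have d1 : 1 <= x + x^-1 - sym_gain s n x by lra.
rewrite sym_gain_step ?gt_eqF //; last exact: sqr_exp_neq.
set d := x + _ - _ in d1 *.
have dE : sym_gain s n x - x^-1 = x - d by rewrite /d; ring.
have -> : d^-1 - x^-1 = (sym_gain s n x - x^-1) * x^-1 * d^-1.
  rewrite dE; clearbody d; field.
  by apply/andP; split; rewrite gt_eqF //; lra.
rewrite normrM normrM (gtr0_norm xV0) exprSr.
have dV : `|d^-1| <= 1 by rewrite ger0_norm ?invr_ge0 ?invf_le1; lra.
rewrite -[leRHS]mulr1 ler_pM ?mulr_ge0 ?normr_ge0 ?(ltW xV0) //.
by rewrite ler_pM2r.
Qed.

End RealGain.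

(** * Gains at complex points outside the unit disc *)

Section ComplexGain.
Variable R : realType.
Local Open Scope complex_scope.
Implicit Types (z w : R[i]).

Lemma normc_sqr z : normc z ^+ 2 = complex.Re z ^+ 2 + complex.Im z ^+ 2.
Proof. by case: z => a b /=; rewrite sqr_sqrtr // addr_ge0 ?sqr_ge0. Qed.

Lemma ImD z w : complex.Im (z + w) = complex.Im z + complex.Im w.
Proof. by case: z w => [a b] [c d]. Qed.

Lemma ImN z : complex.Im (- z) = - complex.Im z.
Proof. by case: z. Qed.

Lemma ImV z : complex.Im z^-1 = - (complex.Im z / normc z ^+ 2).
Proof. by rewrite normc_sqr; case: z. Qed.

Lemma ImV_lt0 z : 0 < complex.Im z -> complex.Im z^-1 < 0.
Proof.
move=> z0; rewrite ImV oppr_lt0 divr_gt0 // normc_sqr.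
by rewrite ltr_wpDl ?sqr_ge0 // exprn_gt0.
Qed.

Lemma normcX z n : normc (z ^+ n) = normc z ^+ n.
Proof. by elim: n => [|n IH]; rewrite ?expr0 ?normc1 // !exprS normcM IH. Qed.

Lemma normc_ge0 z : 0 <= normc z.
Proof. by case: z => u v; exact: sqrtr_ge0. Qed.

Lemma normcN z : normc (- z) = normc z.
Proof. by case: z => u v /=; rewrite !sqrrN. Qed.

Lemma normc_real (x : R) : 0 <= x -> normc x%:C = x.
Proof. by move=> x0; rewrite /= expr0n addr0 sqrtr_sqr ger0_norm. Qed.

Lemma normc_int (s : int) : normc (s%:~R : R[i]) = `|s|%:~R.
Proof.
rewrite -[s%:~R](rmorph_int (real_complex R)) /= expr0n addr0 sqrtr_sqr.
by rewrite -intr_norm.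
Qed.

Lemma outer_neq0 z : 1 < normc z -> z != 0.
Proof. by move=> z1; apply: contraTneq z1 => ->; rewrite normc0 ltr10. Qed.

Lemma outer_neq s z : good_sign s -> 1 < normc z -> forall j, z ^+ j.+1 != s%:~R.
Proof.
move=> s_good z1 j; apply/eqP => /(congr1 (@normc R)) /eqP.
rewrite normcX normc_int gt_eqF // exp_gt_sign //.
by move: s_good; rewrite /good_sign !inE => /or3P[] /eqP ->.
Qed.

Lemma sqr_exp_neqC s z : good_sign s -> 1 < normc z ->
  forall j, (z ^+ 2) ^+ j.+1 != s%:~R.
Proof. by move=> s_good z1; apply: outer_neq; rewrite // normcX exprn_egt1. Qed.

Lemma ImDV_gt0 z : 1 < normc z -> 0 < complex.Im z -> 0 < complex.Im (z + z^-1).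
Proof.
move=> z1 Imz; rewrite ImD ImV.
rewrite -{1}[complex.Im z]mulr1 -mulrBr mulr_gt0 // subr_gt0.
by rewrite invf_lt1 ?exprn_egt1 // exprn_gt0 // (lt_trans _ z1).
Qed.

(** Subtracting a gain of nonpositive imaginary part keeps z + 1/z in the upper half-plane, and
    inversion maps that half-plane to the lower one. *)
Lemma Im_sym_gain s n z : good_sign s -> 1 < normc z -> 0 < complex.Im z ->
  complex.Im (sym_gain s n z) <= 0.
Proof.
move=> s_good z1 Imz; have zNs := sqr_exp_neqC s_good z1.
have z0 := outer_neq0 z1.
have ImzV := ImDV_gt0 z1 Imz.
elim: n => [|n IH].
  rewrite sym_gain0 //; case: (s == 1) => //; case: (s == 0).
    by rewrite ltW // ImV_lt0.
  rewrite mulr_natl mulr2n ImD.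
  by have := ImV_lt0 ImzV; lra.
rewrite sym_gain_step // ltW // ImV_lt0 // ImD ImN; lra.
Qed.

End ComplexGain.

(** * The characteristic function of three branches *)

(** A branch is given by its sign and its length; the pair [(0, 0%N)] stands for an infinite path,
    of gain 1/t. *)
Definition char_fun (K : fieldType) (a b c : int * nat) (t : K) : K :=
  t + 1 - t * (ratio_gain a.1 a.2 t + ratio_gain b.1 b.2 t + ratio_gain c.1 c.2 t).

Definition sym_fun (K : fieldType) (a b c : int * nat) (x : K) : K :=
  x + x^-1 - (sym_gain a.1 a.2 x + sym_gain b.1 b.2 x + sym_gain c.1 c.2 x).

Lemma char_fun_sqr (K : fieldType) (a b c : int * nat) (x : K) : x != 0 ->
  char_fun a b c (x ^+ 2) = x * sym_fun a b c x.
Proof.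
move=> x0; rewrite /char_fun /sym_fun /sym_gain.
by move: (ratio_gain a.1 _ _) (ratio_gain b.1 _ _) (ratio_gain c.1 _ _) => u v w; field.
Qed.

Section Signs.
Variable R : realType.
Variables a b c : int * nat.
Hypotheses (a_good : good_sign a.1) (b_good : good_sign b.1) (c_good : good_sign c.1).

Lemma sym_fun_mono (x y : R) : 1 < x -> x < y -> sym_fun a b c x < sym_fun a b c y.
Proof.
move=> x1 xy; rewrite /sym_fun; have := addV_mono x1 xy.
have := sym_gain_anti a.2 a_good x1 xy; have := sym_gain_anti b.2 b_good x1 xy.
by have := sym_gain_anti c.2 c_good x1 xy; lra.
Qed.

(** The bound 3 is the number of branches, each of gain below 1. *)
Lemma sym_fun_ge3 (x : R) : 3 <= x -> 0 < sym_fun a b c x.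
Proof.
move=> x3; have x1 : 1 < x by lra.
have /andP[_] := sym_gain_bounds a.2 a_good x1.
have /andP[_] := sym_gain_bounds b.2 b_good x1.
have /andP[_] := sym_gain_bounds c.2 c_good x1.
have : 0 < x^-1 by rewrite invr_gt0; lra.
by rewrite /sym_fun; lra.
Qed.

Lemma ratio_gain_real s n (t : R) :
  ratio_gain s n (real_complex R t) = real_complex R (ratio_gain s n t).
Proof. by rewrite /ratio_gain fmorph_div !rmorphB !rmorphXn /= !rmorph_int. Qed.

Lemma char_fun_real (t : R) :
  char_fun a b c (real_complex R t) = real_complex R (char_fun a b c t).
Proof.
rewrite /char_fun !ratio_gain_real.
move: (ratio_gain a.1 _ t) (ratio_gain b.1 _ t) (ratio_gain c.1 _ t) => u v w.
by rewrite rmorphB rmorphM !rmorphD rmorph1.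
Qed.

(** Some square root w of z has nonnegative imaginary part. If that part were positive, w + 1/w and
    the negated gains would all push the imaginary part of [sym_fun] upwards, away from 0. So w is
    real, and its absolute value is the witness. *)
Lemma outer_root_real (z : R[i]) : 1 < normc z -> char_fun a b c z = 0 ->
  exists2 x : R, 1 < x & z = real_complex R (x ^+ 2) /\ sym_fun a b c x = 0.
Proof.
move=> z1 fz; pose w0 := sqrtc z.
pose w := if complex.Im w0 < 0 then - w0 else w0.
have wz : w ^+ 2 = z by rewrite /w; case: ifP; rewrite ?sqrrN sqr_sqrtc.
have Imw : 0 <= complex.Im w.
  by rewrite /w; case: ifP => [|/negbT]; rewrite ?ImN ?oppr_ge0 -?leNgt // => /ltW.
have w1 : 1 < normc w.
  by move: z1; rewrite -wz normcX expr_gt1 ?normc_ge0.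
have w0_neq := outer_neq0 w1.
have fw : sym_fun a b c w = 0.
  by apply/eqP; move/eqP: fz; rewrite -wz char_fun_sqr // mulf_eq0 (negPf w0_neq).
move: Imw; rewrite le_eqVlt => /orP[/eqP Imw0|Imw]; last first.
  have := congr1 (@complex.Im R) fw; rewrite /sym_fun ImD ImN !(ImD (_ + _)) ImD.
  have := ImDV_gt0 w1 Imw; rewrite ImD.
  have := Im_sym_gain a.2 a_good w1 Imw; have := Im_sym_gain b.2 b_good w1 Imw.
  by have := Im_sym_gain c.2 c_good w1 Imw; rewrite /=; lra.
have wE : w = real_complex R (complex.Re w).
  by case: (w) Imw0 => u v /= <-.
have z_real : z = real_complex R (`|complex.Re w| ^+ 2).
  by rewrite -wz {1}wE -rmorphXn /= real_normK ?num_real.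
have x1 : 1 < `|complex.Re w|.
  by move: w1; rewrite wE /= expr0n addr0 sqrtr_sqr.
exists `|complex.Re w| => //; split=> //.
have x0 : `|complex.Re w| != 0 by rewrite gt_eqF // (lt_trans _ x1).
move: fz; rewrite z_real char_fun_real => /complexI.
by rewrite char_fun_sqr // => /eqP; rewrite mulf_eq0 (negPf x0) => /eqP.
Qed.

(** The intermediate value theorem is applied to the polynomial [P] obtained from [char_fun] by
    clearing denominators, between y^2 and 3^2; the cleared denominators are positive beyond 1. *)
Lemma sym_fun_root (y : R) : 1 < y -> sym_fun a b c y < 0 ->
  exists2 x, y <= x & sym_fun a b c x = 0.
Proof.
move=> y1 fy.
pose A k : {poly R} := 'X^(k.2.+1) - (k.1%:~R)%:P.
pose B k : {poly R} := 'X^(k.2) - (k.1%:~R)%:P.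
have hornerA k x : (A k).[x] = x ^+ k.2.+1 - k.1%:~R by rewrite !hornerE.
have hornerB k x : (B k).[x] = x ^+ k.2 - k.1%:~R by rewrite !hornerE.
clearbody A B; pose P : {poly R} := ('X + 1%:P) * (A a * A b * A c) -
  'X * (B a * A b * A c + A a * B b * A c + A a * A b * B c).
have Apos k x : good_sign k.1 -> 1 < x -> 0 < (A k).[x ^+ 2].
  by move=> k_good x1; rewrite hornerA subr_gt0 exp_gt_sign // exprn_egt1.
have PE x : 1 < x -> P.[x ^+ 2] =
    x * (A a * A b * A c).[x ^+ 2] * sym_fun a b c x.
  move=> x1; have x0 : x != 0 by rewrite gt_eqF // (lt_trans _ x1).
  rewrite mulrAC -char_fun_sqr // /char_fun /P.
  rewrite !(hornerD, hornerN, hornerM, hornerX, hornerC).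
  have ratioE k : ratio_gain k.1 k.2 (x ^+ 2) = (B k).[x ^+ 2] / (A k).[x ^+ 2].
    by rewrite /ratio_gain hornerA hornerB.
  rewrite !ratioE; have := Apos _ _ a_good x1; have := Apos _ _ b_good x1.
  have := Apos _ _ c_good x1.
  move: (A a).[_] (A b).[_] (A c).[_] (B a).[_] (B b).[_] (B c).[_] => p q r p' q' r'.
  by move=> r0 q0 p0; field; rewrite !gt_eqF.
have Dpos x : 1 < x -> 0 < x * (A a * A b * A c).[x ^+ 2].
  by move=> x1; rewrite !hornerM !mulr_gt0 ?Apos // (lt_trans _ x1).
have y3 : y < 3.
  by rewrite ltNge; apply: contraTN fy => /sym_fun_ge3; rewrite -leNgt => /ltW.
have le_sqr : y ^+ 2 <= 3 ^+ 2 by rewrite ler_pXn2r ?nnegrE //; lra.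
have [t /andP[yt _] /rootP Pt] : exists2 t, y ^+ 2 <= t <= 3 ^+ 2 & root P t.
  apply: poly_ivt => //; rewrite !PE //; last lra.
  by rewrite pmulr_rle0 ?pmulr_rge0 ?Dpos ?ltW ?sym_fun_ge3 //; lra.
have t1 : 1 < t by rewrite (lt_le_trans _ yt) // exprn_egt1.
have y0 : 0 <= y by lra.
have t0 : 0 <= t by lra.
have yx : y <= Num.sqrt t.
  by rewrite -(ler_pXn2r (_ : 0 < 2)%N) ?nnegrE ?sqrtr_ge0 // sqr_sqrtr.
exists (Num.sqrt t) => //; apply/eqP.
have x1 := lt_le_trans y1 yx.
by move/eqP: Pt; rewrite -{1}(sqr_sqrtr t0) PE // mulf_eq0 gt_eqF ?Dpos.
Qed.

End Signs.

(** * Spectral radii and their limits *)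

Section Rho.
Variable R : realType.
Local Notation toC := (map_poly (intr : int -> R[i])).

Lemma normc_prod (s : seq R[i]) : normc (\prod_(z <- s) z) = \prod_(z <- s) normc z.
Proof. by elim: s => [|z s IH]; rewrite ?big_nil ?normc1 // !big_cons normcM IH. Qed.

Lemma monic_factor (f : {poly int}) : f \is monic ->
  {s : seq R[i] | toC f = \prod_(z <- s) ('X - z%:P)}.
Proof.
move=> f_monic; have [s sE] := closed_field_poly_normal (toC f); exists s.
by rewrite {1}sE (monicP (monic_map _ f_monic)) scale1r.
Qed.

Lemma normc_le_rho (f : {poly int}) (z : R[i]) : f \is monic ->
  root (toC f) z -> normc z <= rho R f.
Proof.
move=> f_monic fz; apply: ub_le_sup; last by exists z.
have [s sE] := monic_factor f_monic.
exists (\sum_(w <- s) normc w) => _ [w /= fw <-].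
rewrite sE root_prod_XsubC in fw.
by rewrite (big_rem w) //= lerDl sumr_ge0 // => u _; exact: normc_ge0.
Qed.

Lemma rho_le (f : {poly int}) (B : R) : (exists z, root (toC f) z) ->
  (forall z, root (toC f) z -> normc z <= B) -> rho R f <= B.
Proof.
move=> [z fz] fB; apply: ge_sup; first by exists (normc z); exists z.
by move=> _ [w /= fw <-]; exact: fB.
Qed.

(** The product of the roots has modulus |f(0)|, which is at least 1 for a nonzero integer. *)
Lemma outer_root_exists (f : {poly int}) : f \is monic -> (1 < size f)%N ->
  f.[0] != 0 -> exists2 z, root (toC f) z & 1 <= normc z.
Proof.
move=> f_monic f_size f0; have [s sE] := monic_factor f_monic.
apply: contrapT => no_root.
have lt1 z : z \in s -> normc z < 1.
  move=> zs; rewrite ltNge; apply/negP => z1; apply: no_root; exists z => //.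
  by rewrite sE root_prod_XsubC.
have s_gt0 : (0 < size s)%N.
  have := size_prod_XsubC s id; rewrite -sE size_map_poly_id0.
    by case: (size s) => // f1; rewrite f1 in f_size.
  by rewrite (monicP f_monic) rmorph1 oner_neq0.
have : normc (toC f).[0] < 1.
  rewrite sE horner_prod; under eq_bigr do rewrite !hornerE.
  rewrite -(big_map (fun z : R[i] => - z) xpredT id) normc_prod big_map.
  under eq_bigr do rewrite normcN.
  case: s lt1 s_gt0 {sE} => // z s lt1 _; rewrite big_cons.
  apply: le_lt_trans (lt1 z (mem_head _ _)); rewrite ler_piMr ?normc_ge0 //.
  rewrite big_seq; apply: prodr_ile1 => w ws.
  by rewrite normc_ge0 ltW // lt1 // inE ws orbT.
rewrite -[0]/(0%:~R) horner_map normc_int -[ltRHS]/(1%:~R) ltr_int.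
by rewrite ltNge -gtz0_ge1 normr_gt0 f0.
Qed.

(** * Locating spectral radii by signs *)

(* The largest root of f on the half-line beyond 1, or 1 if there is none,
   expressed through the signs of f and in terms of the squares of the
   arguments. *)
Definition locates (f : R -> R) (l : R) : Prop :=
  [/\ 1 <= l, forall y, 1 < y -> 0 < f y -> l <= y ^+ 2
    & forall y, 1 < y -> f y < 0 -> y ^+ 2 <= l].

Definition increasing_beyond1 (f : R -> R) : Prop :=
  forall x y, 1 < x -> x < y -> f x < f y.

(** This supplies the inner values of iterated limits without naming a polynomial for them. *)
Lemma locates_exists (f : R -> R) : increasing_beyond1 f ->
  (exists2 x, 1 < x & 0 < f x) -> exists l, locates f l.
Proof.
move=> f_mono [x x1 fx].
pose E : set R := fun l => exists2 y, 1 < y & 0 < f y /\ l = y ^+ 2.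
have E_lb : has_lbound E.
  by exists 1 => _ [y y1 [_ ->]]; rewrite ltW // exprn_egt1.
have E0 : nonempty E by exists (x ^+ 2); exists x.
exists (inf E); split=> [|y y1 fy|y y1 fy].
- by apply: lb_le_inf => // _ [y y1 [_ ->]]; rewrite ltW // exprn_egt1.
- by apply: ge_inf => //; exists y.
apply: lb_le_inf => // _ [w w1 [fw ->]].
rewrite ler_pXn2r ?nnegrE //; try lra.
have [//|wy] := leP y w; have := f_mono _ _ w1 wy; lra.
Qed.

(** Near l there are points on either side at which f has a strict sign. For large n the function
    [f_ n] has the same signs there, which traps [l_ n]. If l - e is below 1, the lower bound is
    just [1 <= l_ n]. *)
Lemma locates_cvg (f_ : nat -> R -> R) (f : R -> R) (l_ : nat -> R) (l : R) :
  increasing_beyond1 f -> (forall x, 1 < x -> f_ n x @[n --> \oo] --> f x) ->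
  (\forall n \near \oo, locates (f_ n) (l_ n)) -> locates f l ->
  l_ n @[n --> \oo] --> l.
Proof.
move=> f_mono f_cvg f_l [l1 l_pos l_neg].
have mid (x y : R) : 1 <= x -> x < y -> exists2 w, 1 < w & x < w ^+ 2 < y.
  move=> x1 xy; have m1 : 1 < (x + y) / 2 by lra.
  exists (Num.sqrt ((x + y) / 2)); last first.
    by rewrite sqr_sqrtr; [apply/andP; split; lra | lra].
  by rewrite -[X in X < _]sqrtr1 ltr_sqrt; lra.
apply/cvgrPdist_lt => e e0.
have [y y1 /andP[ly yle]] := mid l (l + e) l1 ltac:(lra).
have fy : 0 < f y.
  (* [locates] only excludes a negative value beyond l; a second point in between and strict
     monotonicity make the sign at [y] strict. *)
  have [w w1 /andP[lw wy]] := mid l (y ^+ 2) l1 ly.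
  have fw : 0 <= f w by rewrite leNgt; apply/negP => /(l_neg w w1); lra.
  apply: le_lt_trans fw (f_mono w y w1 _).
  by rewrite -(ltr_pXn2r (_ : 0 < 2)%N) ?nnegrE //; lra.
have upper : \forall n \near \oo, 0 < f_ n y.
  exact: (cvgr_gt (f y) (f_cvg y y1)).
have lower : \forall n \near \oo, locates (f_ n) (l_ n) -> l - e < l_ n.
  have [le1|le1] := ltP (l - e) 1.
    by near=> n => -[ln1 _ _]; apply: lt_le_trans ln1.
  have [x x1 /andP[lx xl]] := mid (l - e) l le1 ltac:(lra).
  have fx : f x < 0.
    have [w w1 /andP[xw wl]] := mid (x ^+ 2) l ltac:(lra) xl.
    have fw : f w <= 0 by rewrite leNgt; apply/negP => /(l_pos w w1); lra.
    apply: lt_le_trans (f_mono x w x1 _) fw.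
    by rewrite -(ltr_pXn2r (_ : 0 < 2)%N) ?nnegrE //; lra.
  have : \forall n \near \oo, f_ n x < 0 by exact: (cvgr_lt (f x) (f_cvg x x1)).
  by apply: filterS => n fnx [_ _ /(_ x x1 fnx)]; lra.
near=> n.
have ln : locates (f_ n) (l_ n) by near: n.
have lo : locates (f_ n) (l_ n) -> l - e < l_ n by near: n.
have up : 0 < f_ n y by near: n.
have [_ /(_ y y1 up) lny _] := ln; move/(_ ln): lo => lo.
rewrite ltr_norml; apply/andP; split; lra.
Unshelve. all: by end_near.
Qed.

Lemma poly_locates (f : {poly int}) (F : R -> R) : f \is monic ->
  (exists2 z, root (toC f) z & 1 <= normc z) ->
  (forall z, 1 < normc z -> root (toC f) z ->
     exists2 x : R, 1 < x & z = real_complex R (x ^+ 2) /\ F x = 0) ->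
  (forall x, 1 < x -> F x = 0 -> root (toC f) (real_complex R (x ^+ 2))) ->
  increasing_beyond1 F ->
  (forall y, 1 < y -> F y < 0 -> exists2 x, y <= x & F x = 0) ->
  locates F (rho R f).
Proof.
move=> f_monic [z0 fz0 z01] root_F F_root F_mono F_ivt.
split=> [|y y1 Fy|y y1 /(F_ivt y y1)[x yx Fx]].
- exact: le_trans z01 (normc_le_rho f_monic fz0).
- apply: rho_le; first by exists z0.
  move=> z fz; have [z1|z1] := leP (normc z) 1.
    by apply: le_trans z1 _; rewrite ltW // exprn_egt1.
  have [x x1 [-> Fx]] := root_F z z1 fz.
  rewrite normc_real ?sqr_ge0 //.
  rewrite ler_pXn2r ?nnegrE //; try lra.
  have [//|yx] := leP x y; have := F_mono _ _ y1 yx; lra.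
have x1 := lt_le_trans y1 yx.
have := normc_le_rho f_monic (F_root x x1 Fx).
rewrite normc_real ?sqr_ge0 //.
by apply: le_trans; rewrite ler_pXn2r ?nnegrE //; lra.
Qed.

Definition sym_good (a b c : int * nat) :=
  [&& good_sign a.1, good_sign b.1 & good_sign c.1].

Lemma sym_fun_locates (f : {poly int}) (a b c : int * nat) :
  sym_good a b c -> f \is monic ->
  (exists2 z, root (toC f) z & 1 <= normc z) ->
  (forall z, 1 < normc z -> root (toC f) z <-> char_fun a b c z = 0) ->
  locates (sym_fun a b c) (rho R f).
Proof.
move=> /and3P[ag bg cg] f_monic f1 f_char; apply: poly_locates => //.
- by move=> z z1 /(f_char z z1); apply: outer_root_real.
- move=> x x1 Fx; apply/f_char; last first.
    rewrite char_fun_real // char_fun_sqr ?Fx ?mulr0 //.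
    by rewrite gt_eqF // (lt_trans _ x1).
  by rewrite /= expr0n addr0 sqrtr_sqr ger0_norm ?sqr_ge0 // exprn_egt1.
- by move=> x y; apply: sym_fun_mono.
- by move=> y; apply: sym_fun_root.
Qed.

Lemma sym_gain_cvg i j (x : R) : 1 < x ->
  sym_gain (branch_sign i j) (branch_length i j n) x @[n --> \oo] --> x^-1.
Proof.
move=> x1; have x0 : 0 < x by apply: lt_trans x1.
(* The factor [x ^+ 2] absorbs the shift in the length n - 2 of a branch D_n. *)
have pow_cvg : x ^+ 2 * x^-1 ^+ n @[n --> \oo] --> 0.
  rewrite -[X in _ --> X](mulr0 (x ^+ 2)); apply: cvgMr.
  by apply: cvg_expr; rewrite ger0_norm ?invf_lt1 // invr_ge0 ltW.
apply/cvgrPdist_le => e e0; move/cvgrPdist_le: pow_cvg => /(_ e e0).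
apply: filterS => n; rewrite sub0r normrN ger0_norm; last first.
  by rewrite mulr_ge0 // exprn_ge0 // ?invr_ge0 ltW.
apply: le_trans; rewrite distrC.
have sgood : good_sign (branch_sign i j) by rewrite /branch_sign; case: ifP.
apply: le_trans (sym_gain_dist _ sgood x1) _.
rewrite exprVn exprVn ler_pdivlMr ?exprn_gt0 // mulrC ler_pdivrMr ?exprn_gt0 //.
rewrite -exprD ler_weXn2l ?ltW // /branch_length; case: ifP; lia.
Qed.

Lemma sym_gain_infinite (x : R) : 1 < x -> sym_gain 0 0 x = x^-1.
Proof.
move=> x1; rewrite sym_gain0 //; first by rewrite gt_eqF // (lt_trans _ x1).
by apply: sqr_exp_neq.
Qed.
End Rho.

Definition branch_index (i j n : nat) : int * nat :=
  (branch_sign i j, branch_length i j n).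

Lemma branch_sign_good i j : good_sign (branch_sign i j).
Proof. by rewrite /branch_sign; case: ifP. Qed.

(** For the eigenvalue 0 the equation expresses [v u] through neighbours of smaller rank alone, so
    [v] vanishes by induction on the rank. *)
Lemma cox_horner0 (T : finType) (e : rel T) : irreflexive e -> (cox e).[0] != 0.
Proof.
move=> e_irr; apply/eqP => e0.
have /root_coxP[v [u vu] vP] : root (map_poly intr (cox e)) (0 : rat).
  by apply/rootP; rewrite -[0]/(0%:~R) horner_map e0.
suff v0 m w : (enum_rank w < m)%N -> v w = 0 by rewrite (v0 _ _ (ltnSn _)) eqxx in vu.
elim: m w => // m IH w wm; have := vP w; rewrite add0r mul1r => ->.
rewrite big1 // => x ewx; case: ltnP => [_|xw]; first by rewrite mul0r.
rewrite ltnS in wm; rewrite IH ?mulr0 //; apply: leq_trans wm.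
rewrite ltn_neqAle xw andbT.
by apply: contraTneq ewx => /val_inj/enum_rank_inj ->; rewrite e_irr.
Qed.

Lemma join_edge_irr (I : finType) (G : I -> rooted_graph) :
  (forall i, irreflexive (@edge (G i))) -> irreflexive (join_edge G).
Proof. by move=> G_irr [[i m]|] //=; rewrite eqxx tagged_asE G_irr. Qed.

Lemma S_edge_irr i p q r : irreflexive (join_edge (S_branch i p q r)).
Proof.
apply: join_edge_irr => j; rewrite /S_branch; case: ifP => _ u /=; last lia.
by rewrite /dynkinD_arc; lia.
Qed.

(** * The polynomials F^(i)_(p,q) as numerators *)

Lemma monic_sub (g h : {poly int}) : g \is monic -> (size h < size g)%N ->
  g - h \is monic /\ size (g - h) = size g.
Proof.
move=> g_monic hg; rewrite -size_polyN in hg.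
by rewrite monicE lead_coefDl // (monicP g_monic) eqxx size_polyDl.
Qed.

Lemma size_coxA n : size (coxA n) = n.+1.
Proof. by rewrite size_char_poly card_ord. Qed.

Lemma coxA_horner (K : fieldType) n (z : K) :
  (z - 1) * (map_poly intr (coxA n)).[z] = z ^+ n.+1 - 1.
Proof.
have := congr1 (fun f => (map_poly (intr : int -> K) f).[z]) (coxA_geometric n).
by rewrite /= rmorphM !rmorphB /= map_polyX map_polyXn rmorph1 !hornerE.
Qed.

Lemma coxA_horner0 n : (coxA n).[0] = 1.
Proof.
have := congr1 (fun f : {poly int} => f.[0]) (coxA_geometric n).
by rewrite /= !hornerE exprS mul0r sub0r mulN1r => /oppr_inj.
Qed.

Lemma size_Xn1 n : (0 < n)%N -> size ('X^n + 1 : {poly int}) = n.+1.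
Proof. by move=> n0; rewrite size_XnaddC. Qed.

Lemma Fpoly_monic i p q : (i <= 2)%N -> admissible i 0 p -> admissible i 1 q ->
  Fpoly i p q \is monic /\ (1 < size (Fpoly i p q))%N.
Proof.
have size_prod (f g : {poly int}) m : (size f + size g <= m.+1)%N ->
    (size (f * g)%R <= m)%N.
  by have := size_polyMleq f g; lia.
have monicX1 : 'X - 1 \is @monic int by rewrite -[1]/(1%:P) monicXsubC.
case: i => [|[|[|i]]] // _; rewrite /admissible /Fpoly /= => p_ge q_ge.
- have [] := @monic_sub 'X^(p + q) (coxA (p - 1) * coxA (q - 1)) (monicXn _ _).
    by rewrite size_polyXn ltnS size_prod // !size_coxA; lia.
  by move=> -> ->; rewrite size_polyXn; split=> //; lia.
- have sz : size ('X^(p + q - 2) * ('X - 1) : {poly int}) = (p + q)%N.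
    rewrite size_Mmonic ?monic_neq0 ?monicXn // size_polyXn.
    by rewrite -[1]/(1%:P) size_XsubC; lia.
  have [] := @monic_sub ('X^(p + q - 2) * ('X - 1))
      (('X^(p - 2) + 1) * coxA (q - 1)).
  + by rewrite monicMl ?monicXn.
  + have := @size_prod ('X^(p - 2) + 1) (coxA (q - 1)) (p + q - 2)%N.
    by rewrite sz size_Xn1 ?size_coxA; lia.
  by move=> -> ->; rewrite sz; split=> //; lia.
have monicX12 : ('X - 1) ^+ 2 \is @monic int by rewrite rpredX.
have sz : size ('X^(p + q - 4) * ('X - 1) ^+ 2 : {poly int}) = (p + q - 1)%N.
  rewrite size_Mmonic ?monic_neq0 ?monicXn // size_polyXn.
  by rewrite -[1]/(1%:P) size_exp_XsubC; lia.
have [] := @monic_sub ('X^(p + q - 4) * ('X - 1) ^+ 2)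
    (('X^(p - 2) + 1) * ('X^(q - 2) + 1)).
+ by rewrite monicMl ?monicXn.
+ have := @size_prod ('X^(p - 2) + 1) ('X^(q - 2) + 1) (p + q - 3)%N.
  by rewrite sz !size_Xn1; lia.
by move=> -> ->; rewrite sz; split=> //; lia.
Qed.

Lemma Fpoly_horner0 i p q : (i <= 2)%N -> admissible i 0 p -> admissible i 1 q ->
  (Fpoly i p q).[0] = -1.
Proof.
have exp0 m : (0 < m)%N -> (0 : int) ^+ m = 0 by move=> m0; rewrite expr0n gtn_eqF.
case: i => [|[|[|i]]] // _; rewrite /admissible /Fpoly /= => p_ge q_ge.
- by rewrite !hornerE !coxA_horner0 exp0 //; lia.
- by rewrite !hornerE !coxA_horner0 !exp0 //; lia.
by rewrite !hornerE !exp0 //; lia.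
Qed.

(** With third gain 1/z and the other gains N_j/D_j, [char_fun] equals z (1 - N_1/D_1 - N_2/D_2).
    Clearing denominators leaves z times (D_1 - N_1)(D_2 - N_2) - N_1 N_2, where D_j - N_j is z - 1
    times a power of z. Each of the 2 - i branches of type A gives a further factor z - 1 in its
    N_j, which cancels against cox_A. *)
Lemma Fpoly_horner (K : fieldType) i p q (z : K) :
  (i <= 2)%N -> admissible i 0 p -> admissible i 1 q -> z != 0 ->
  (forall j, z ^+ j.+1 != 1) -> (forall j, z ^+ j.+1 != -1) ->
  (z - 1) ^+ (2 - i) * z * (map_poly intr (Fpoly i p q)).[z] =
  (z ^+ (branch_length i 0 p).+1 - (branch_sign i 0)%:~R) *
  (z ^+ (branch_length i 1 q).+1 - (branch_sign i 1)%:~R) *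
  char_fun (branch_index i 0 p) (branch_index i 1 q) (0, 0%N) z.
Proof.
move=> i2 p_ge q_ge z0 zN1 zNN1.
have ND1 j : z ^+ j.+1 - 1 != 0 by rewrite subr_eq0.
have ND2 j : z ^+ j.+1 + 1 != 0 by rewrite -[1]opprK subr_eq0.
rewrite /char_fun /ratio_gain /= expr0 expr1 !subr0 div1r.
case: i i2 p_ge q_ge => [|[|[|i]]] // _;
  rewrite /admissible /Fpoly /branch_sign /branch_length /= => p_ge q_ge.
- case: p p_ge => // p _; case: q q_ge => // q _; rewrite !subSS !subn0.
  rewrite rmorphB rmorphM /= map_polyXn !hornerE.
  set A := (map_poly _ (coxA p)).[z]; set B := (map_poly _ (coxA q)).[z].
  have AE : z ^+ p.+1 = 1 + (z - 1) * A by rewrite coxA_horner addrC subrK.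
  have BE : z ^+ q.+1 = 1 + (z - 1) * B by rewrite coxA_horner addrC subrK.
  have := ND1 p.+1; have := ND1 q.+1; rewrite exprD !(exprS z _.+1) AE BE.
  by move: A B {AE BE} => u v n1 n2; field; rewrite ?z0 ?n1 ?n2.
- case: q q_ge => // q _; have [m ->] : exists m, p = m.+3 by exists (p - 3)%N; lia.
  have [-> -> ->] : [/\ m.+3 + q.+1 - 2 = m.+1 + q.+1, m.+3 - 2 = m.+1 &
    q.+1 - 1 = q]%N by split; lia.
  rewrite rmorphB !rmorphM rmorphB rmorphD /= !map_polyXn map_polyX !rmorph1 !hornerE.
  set B := (map_poly _ (coxA q)).[z].
  have BE : z ^+ q.+1 = 1 + (z - 1) * B by rewrite coxA_horner addrC subrK.
  have := ND2 m.+1; have := ND1 q.+1; rewrite exprD !(exprS z _.+1) BE !rmorphN1 !opprK.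
  by move: B {BE} (z ^+ m.+1) => u v n1 n2; field; rewrite ?z0 ?n1 ?n2.
have [m ->] : exists m, p = m.+3 by exists (p - 3)%N; lia.
have [l ->] : exists l, q = l.+3 by exists (q - 3)%N; lia.
have [-> -> ->] : [/\ m.+3 + l.+3 - 4 = m.+1 + l.+1, m.+3 - 2 = m.+1 &
  l.+3 - 2 = l.+1]%N by split; lia.
rewrite rmorphB !rmorphM rmorphXn rmorphB !rmorphD /= !map_polyXn map_polyX.
rewrite !rmorph1 !hornerE.
have := ND2 m.+1; have := ND2 l.+1; rewrite !rmorphN1 !opprK exprD !(exprS z _.+1).
by rewrite /=; move: (z ^+ l.+1) (z ^+ m.+1) => u v n1 n2; field; rewrite ?z0 ?n1 ?n2.
Qed.

(** * Convergence of the spectral radii *)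

Section Limits.
Variable R : realType.
Local Notation toC := (map_poly (intr : int -> R[i])).

Lemma coxS_locates i p q r :
  (0 < i -> 3 <= p)%N -> (1 < i -> 3 <= q)%N -> (2 < i -> 3 <= r)%N ->
  locates (sym_fun (branch_index i 0 p) (branch_index i 1 q) (branch_index i 2 r))
          (rho R (coxS i p q r)).
Proof.
move=> p3 q3 r3; apply: sym_fun_locates.
- by rewrite /sym_good /= !branch_sign_good.
- exact: char_poly_monic.
- apply: outer_root_exists; first exact: char_poly_monic.
    by rewrite size_char_poly ltnS; apply/card_gt0P; exists None.
  exact/cox_horner0/S_edge_irr.
- move=> z z1; apply: root_coxS => // j.
    exact: (@outer_neq R 1).
  exact: (@outer_neq R (-1)).
Qed.

Lemma Fpoly_root i p q (z : R[i]) :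
  (i <= 2)%N -> admissible i 0 p -> admissible i 1 q -> 1 < normc z ->
  root (toC (Fpoly i p q)) z <->
  char_fun (branch_index i 0 p) (branch_index i 1 q) (0, 0%N) z = 0.
Proof.
move=> i2 p_ge q_ge z1; have z0 := outer_neq0 z1.
have zN1 := @outer_neq R 1 z isT z1; have zNN1 := @outer_neq R (-1) z isT z1.
have := Fpoly_horner i2 p_ge q_ge z0 zN1 zNN1.
set D1 := _ ^+ _ - (branch_sign i 0)%:~R.
set D2 := _ ^+ _ - (branch_sign i 1)%:~R => FE.
have D10 : D1 != 0 by rewrite subr_eq0 outer_neq // branch_sign_good.
have D20 : D2 != 0 by rewrite subr_eq0 outer_neq // branch_sign_good.
have z10 : z - 1 != 0 by rewrite subr_eq0; have := zN1 0%N; rewrite expr1.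
split=> [/rootP Fz|fz].
  move/eqP: FE; rewrite Fz mulr0 eq_sym !mulf_eq0 (negPf D10) (negPf D20).
  by move/eqP.
apply/rootP/eqP; move/eqP: FE; rewrite fz mulr0 !mulf_eq0 expf_eq0.
by rewrite (negPf z10) (negPf z0) andbF.
Qed.

Lemma Fpoly_locates i p q :
  (i <= 2)%N -> admissible i 0 p -> admissible i 1 q ->
  locates (sym_fun (branch_index i 0 p) (branch_index i 1 q) (0, 0%N))
          (rho R (Fpoly i p q)).
Proof.
move=> i2 p_ge q_ge; have [F_monic F_size] := Fpoly_monic i2 p_ge q_ge.
apply: sym_fun_locates => //.
- by rewrite /sym_good /= !branch_sign_good.
- by apply: outer_root_exists; rewrite // Fpoly_horner0.
- by move=> z; apply: Fpoly_root.
Qed.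

(** Two gains 1/z reduce [char_fun] to z - 1 - z g, where g is the gain of A_r; the polynomial is
    this times the denominator z^(r+1) - 1 of g. *)
Lemma two_infinite_A_locates (r : nat) :
  locates (sym_fun (0, 0%N) (0, 0%N) (1, r))
          (rho R ('X^(r + 2) - 2 *: 'X^(r + 1) + 1)).
Proof.
set f : {poly int} := _ + 1.
have hornerE_f (K : fieldType) (z : K) :
    (map_poly intr f).[z] = z ^+ r.+2 - 2 * z ^+ r.+1 + 1.
  rewrite /f addn1 addn2 rmorphD rmorphB /= map_polyZ /=.
  by rewrite !map_polyXn rmorph1 rmorph_nat !hornerE.
have [f_monic f_size] : f \is monic /\ size f = r.+3.
  have -> : f = 'X^(r.+2) - (2 *: 'X^(r.+1) - 1).
    by rewrite /f addn1 addn2 opprD opprK addrA.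
  have [] := @monic_sub 'X^(r.+2) (2 *: 'X^(r.+1) - 1) (monicXn _ _).
    rewrite size_polyXn ltnS (leq_trans (size_polyD _ _)) // size_polyN size_poly1.
    by rewrite geq_max (leq_trans (size_scale_leq _ _)) // size_polyXn.
  by rewrite size_polyXn.
apply: sym_fun_locates => //.
(* The root 1 covers r = 0 too, where the polynomial is (X - 1)^2 and has no root beyond the unit
   circle. *)
- exists 1; last by rewrite normc1.
  by apply/rootP; rewrite hornerE_f !expr1n; ring.
- move=> z z1; have z0 := outer_neq0 z1.
  have D0 : z ^+ r.+1 - 1 != 0 by rewrite subr_eq0 (@outer_neq R 1).
  have -> : char_fun (0, 0%N) (0, 0%N) (1, r) z =
      (map_poly intr f).[z] / (z ^+ r.+1 - 1).
    rewrite hornerE_f /char_fun /ratio_gain /= expr0 expr1 !subr0 div1r.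
    rewrite !exprS in D0 *; move: (z ^+ r) D0 => u D0.
    by field; rewrite z0 D0.
  split=> [/rootP ->|/eqP]; first by rewrite mul0r.
  by rewrite mulf_eq0 invr_eq0 (negPf D0) orbF => /eqP/rootP.
Qed.

Lemma D_two_infinite_locates (p : nat) : (3 <= p)%N ->
  locates (sym_fun (-1, (p - 2)%N) (0, 0%N) (0, 0%N))
          (rho R ('X^p - 2 *: 'X^(p - 1) - 1)).
Proof.
move=> p3; have [m ->] : exists m, p = m.+3 by exists (p - 3)%N; lia.
rewrite !subSS !subn0; set f : {poly int} := _ - 1.
have hornerE_f (K : fieldType) (z : K) :
    (map_poly intr f).[z] = z ^+ m.+3 - 2 * z ^+ m.+2 - 1.
  rewrite /f !rmorphB /= map_polyZ /=.
  by rewrite !map_polyXn rmorph1 rmorph_nat !hornerE.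
have [f_monic f_size] : f \is monic /\ size f = m.+4.
  have -> : f = 'X^(m.+3) - (2 *: 'X^(m.+2) + 1) by rewrite /f opprD addrA.
  have [] := @monic_sub 'X^(m.+3) (2 *: 'X^(m.+2) + 1) (monicXn _ _).
    rewrite size_polyXn ltnS (leq_trans (size_polyD _ _)) // size_poly1.
    by rewrite geq_max (leq_trans (size_scale_leq _ _)) // size_polyXn.
  by rewrite size_polyXn.
apply: sym_fun_locates => //.
- apply: outer_root_exists; rewrite // ?f_size //.
  by rewrite /f !hornerD !hornerN hornerZ !hornerXn hornerC !exprS !mul0r.
- move=> z z1; have z0 := outer_neq0 z1.
  have D0 : z ^+ m.+2 + 1 != 0.
    by rewrite -[1]opprK subr_eq0 (@outer_neq R (-1)).
  have -> : char_fun (-1, m.+1) (0, 0%N) (0, 0%N) z =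
      (map_poly intr f).[z] / (z ^+ m.+2 + 1).
    rewrite hornerE_f /char_fun /ratio_gain /= expr0 expr1 !subr0 div1r.
    rewrite rmorphN1 !opprK !exprS in D0 *; move: (z ^+ m) D0 => u D0.
    by field; rewrite z0 D0.
  split=> [/rootP ->|/eqP]; first by rewrite mul0r.
  by rewrite mulf_eq0 invr_eq0 (negPf D0) orbF => /eqP/rootP.
Qed.

(** With three gains 1/x the function is x - 2/x, which changes sign where x^2 = 2. *)
Lemma three_infinite_locates :
  locates (sym_fun (0, 0%N) (0, 0%N) (0, 0%N)) (2 : R).
Proof.
have symE (y : R) : 1 < y ->
    sym_fun (0, 0%N) (0, 0%N) (0, 0%N) y = (y ^+ 2 - 2) / y.
  move=> y1; rewrite /sym_fun !sym_gain_infinite //.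
  by field; rewrite gt_eqF // (lt_trans _ y1).
split=> [|y y1|y y1]; first lra; have y0 : 0 < y by apply: lt_trans y1.
  by rewrite symE // pmulr_lgt0 ?invr_gt0 // => h; lra.
by rewrite symE // pmulr_llt0 ?invr_gt0 // => h; lra.
Qed.

Definition branch_cvg (a_ : nat -> int * nat) (a : int * nat) : Prop :=
  forall x : R, 1 < x ->
    sym_gain (a_ n).1 (a_ n).2 x @[n --> \oo] --> sym_gain a.1 a.2 x.

Lemma branch_cvg_cst a : branch_cvg (fun=> a) a.
Proof. by move=> x x1; exact: cvg_cst. Qed.

Lemma branch_index_cvg i j : branch_cvg (branch_index i j) (0, 0%N).
Proof. by move=> x x1; rewrite /= sym_gain_infinite //; exact: sym_gain_cvg. Qed.

Lemma sym_fun_locates_cvg (a_ b_ c_ : nat -> int * nat) (a b c : int * nat)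
    (l_ : nat -> R) (l : R) :
  branch_cvg a_ a -> branch_cvg b_ b -> branch_cvg c_ c -> sym_good a b c ->
  (\forall n \near \oo, locates (sym_fun (a_ n) (b_ n) (c_ n)) (l_ n)) ->
  locates (sym_fun a b c) l -> is_lim1 l_ l.
Proof.
move=> a_cvg b_cvg c_cvg /and3P[ag bg cg] ln_loc l_loc.
apply: (locates_cvg _ _ ln_loc l_loc); first by move=> x y; exact: sym_fun_mono.
move=> x x1; apply: cvgB; first exact: cvg_cst.
by apply: cvgD; [apply: cvgD; [exact: a_cvg | exact: b_cvg] | exact: c_cvg].
Qed.

Lemma sym_fun_locates_exists (a b c : int * nat) : sym_good a b c ->
  exists l : R, locates (sym_fun a b c) l.
Proof.
move=> /and3P[ag bg cg]; apply: locates_exists.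
  by move=> x y; exact: sym_fun_mono.
by exists 3; [lra | exact: sym_fun_ge3].
Qed.

Lemma limit_r i p q : (i <= 2)%N -> admissible i 0 p -> admissible i 1 q ->
  is_lim1 (fun r => rho R (coxS i p q r)) (rho R (Fpoly i p q)).
Proof.
move=> i2 p_ge q_ge; apply: (sym_fun_locates_cvg (@branch_cvg_cst _)
  (@branch_cvg_cst _) (@branch_index_cvg i 2) _ _ (Fpoly_locates i2 p_ge q_ge)).
  by rewrite /sym_good /= !branch_sign_good.
near=> r; apply: coxS_locates; try lia.
- by move: p_ge; rewrite /admissible; case: ifP => // ->.
- by move: q_ge; rewrite /admissible; case: ifP => // ->.
Unshelve. all: by end_near.
Qed.

(** The function is symmetric in the branches, so the infinite one can be moved to the last place;
    one D branch fewer remains, whence the index i - 1. *)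
Lemma limit_p i q r : (1 <= i <= 3)%N -> admissible i 1 q -> admissible i 2 r ->
  is_lim1 (fun p => rho R (coxS i p q r)) (rho R (Fpoly (i - 1) q r)).
Proof.
case: i => [|i] //; rewrite subSS subn0 ltnS => /= i2 q_ge r_ge.
have := Fpoly_locates i2 q_ge r_ge.
have -> : sym_fun (branch_index i 0 q) (branch_index i 1 r) (0, 0%N) =
    sym_fun (0, 0%N) (branch_index i.+1 1 q) (branch_index i.+1 2 r) :> (R -> R).
  apply/funext => x; rewrite /sym_fun /branch_index /branch_sign /branch_length /=.
  by rewrite !ltnS; congr (_ - _); rewrite addrC addrA.
apply: (sym_fun_locates_cvg (@branch_index_cvg i.+1 0) (@branch_cvg_cst _)
  (@branch_cvg_cst _)).
  by rewrite /sym_good /= !branch_sign_good.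
near=> p; apply: coxS_locates.
- by move=> _; near: p; exact: nbhs_infty_ge.
- by move: q_ge; rewrite /admissible; case: ifP => // ->.
- by move: r_ge; rewrite /admissible; case: ifP => // ->.
Unshelve. all: by end_near.
Qed.

Lemma sym_good_index i j n i' j' n' :
  sym_good (branch_index i j n) (branch_index i' j' n') (0, 0%N).
Proof. by rewrite /sym_good /= !branch_sign_good. Qed.

Lemma limit_pq i r : (i <= 2)%N ->
  is_lim2 (fun p q => rho R (coxS i p q r))
          (rho R ('X^(r + 2) - 2 *: 'X^(r + 1) + 1)).
Proof.
move=> i2; have good p :
    sym_good (branch_index i 0 p) (0, 0%N) (branch_index i 2 r).
  by rewrite /sym_good /= !branch_sign_good.
(* The inner limit [v p] is known only through the signs of the function whose second branch is
   infinite; that suffices for both limits. *)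
have [v v_loc] := choice (fun p => sym_fun_locates_exists (good p)).
exists v.
  near=> p; apply: (sym_fun_locates_cvg (@branch_cvg_cst _)
    (@branch_index_cvg i 1) (@branch_cvg_cst _) (good p) _ (v_loc p)).
  near=> q; apply: coxS_locates; try lia.
  - by move=> _; near: p; exact: nbhs_infty_ge.
  - by move=> _; near: q; exact: nbhs_infty_ge.
have index_r : branch_index i 2 r = (1, r).
  by rewrite /branch_index /branch_sign /branch_length ltnNge i2.
rewrite index_r in v_loc.
apply: (sym_fun_locates_cvg (@branch_index_cvg i 0) (@branch_cvg_cst _)
  (@branch_cvg_cst _) _ _ (two_infinite_A_locates r)) => //.
by near=> p; exact: v_loc.
Unshelve. all: by end_near.
Qed.

Lemma limit_qr i p : (1 <= i <= 3)%N -> (3 <= p)%N ->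
  is_lim2 (fun q r => rho R (coxS i p q r))
          (rho R ('X^p - 2 *: 'X^(p - 1) - 1)).
Proof.
move=> /andP[i1 _] p3.
have [v v_loc] := choice (fun q => sym_fun_locates_exists (sym_good_index i 0 p i 1 q)).
exists v.
  near=> q; apply: (sym_fun_locates_cvg (@branch_cvg_cst _)
    (@branch_cvg_cst _) (@branch_index_cvg i 2) _ _ (v_loc q)).
    exact: sym_good_index.
  near=> r; apply: coxS_locates => // _.
  - by near: q; exact: nbhs_infty_ge.
  - by near: r; exact: nbhs_infty_ge.
have index_p : branch_index i 0 p = (-1, (p - 2)%N).
  by rewrite /branch_index /branch_sign /branch_length i1.
rewrite index_p in v_loc.
apply: (sym_fun_locates_cvg (@branch_cvg_cst _) (@branch_index_cvg i 1)
  (@branch_cvg_cst _) _ _ (D_two_infinite_locates p3)) => //.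
by near=> q; exact: v_loc.
Unshelve. all: by end_near.
Qed.

Lemma limit_pqr i : is_lim3 (fun p q r => rho R (coxS i p q r)) 2.
Proof.
have good p : sym_good (branch_index i 0 p) (0, 0%N) (0, 0%N).
  by rewrite /sym_good /= !branch_sign_good.
have [v v_loc] := choice (fun p => sym_fun_locates_exists (good p)).
exists v; last first.
  apply: (sym_fun_locates_cvg (@branch_index_cvg i 0) (@branch_cvg_cst _)
    (@branch_cvg_cst _) _ _ three_infinite_locates) => //.
  by near=> p; exact: v_loc.
near=> p.
have [w w_loc] := choice (fun q => sym_fun_locates_exists (sym_good_index i 0 p i 1 q)).
exists w; last first.
  apply: (sym_fun_locates_cvg (@branch_cvg_cst _) (@branch_index_cvg i 1)
    (@branch_cvg_cst _) (good p) _ (v_loc p)).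
  by near=> q; exact: w_loc.
near=> q; apply: (sym_fun_locates_cvg (@branch_cvg_cst _)
  (@branch_cvg_cst _) (@branch_index_cvg i 2) _ _ (w_loc q)).
  exact: sym_good_index.
near=> r; apply: coxS_locates => _.
- by near: p; exact: nbhs_infty_ge.
- by near: q; exact: nbhs_infty_ge.
- by near: r; exact: nbhs_infty_ge.
Unshelve. all: by end_near.
Qed.
End Limits.

(** * Pisot numbers *)

Section MinimalPolynomial.
Variables (K : numFieldType).

Lemma map_ratr_intr (f : {poly int}) :
  map_poly (ratr : rat -> K) (map_poly intr f) = map_poly intr f.
Proof. by rewrite -map_poly_comp; apply: eq_map_poly => a /=; rewrite ratr_int. Qed.

Lemma irreducible_dvd (f g : {poly rat}) (x : K) : irreducible_poly f ->
  root (map_poly ratr f) x -> root (map_poly ratr g) x -> f %| g.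
Proof.
move=> [f_size f_irr] fx gx.
have gcd_root : root (map_poly ratr (gcdp f g)) x by rewrite gcdp_map root_gcd fx.
have gcd_size : size (gcdp f g) != 1%N.
  apply/negP => /size_poly1P[c c0 gcdE]; move: gcd_root.
  by rewrite gcdE map_polyC rootC fmorph_eq0 (negPf c0).
by rewrite -(eqp_dvdl _ (f_irr _ gcd_size (dvdp_gcdl _ _))) dvdp_gcdr.
Qed.

Lemma root_dvd (f g : {poly int}) (x : K) :
  (map_poly intr f : {poly rat}) %| map_poly intr g ->
  root (map_poly intr f) x -> root (map_poly intr g) x.
Proof.
rewrite -(dvdp_map (ratr : {rmorphism rat -> K})) !map_ratr_intr => /dvdpP[q ->] fx.
by rewrite rootM fx orbT.
Qed.

Lemma size_map_intr (L : numDomainType) (f : {poly int}) :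
  size (map_poly (intr : int -> L) f) = size f.
Proof. by apply: size_map_inj_poly; [exact: intr_inj | exact: rmorph0]. Qed.

(** Among the monic integer polynomials with root x one of least degree is taken. By Gauss's lemma a
    rational factor is proportional to an integer one, whose leading coefficient and that of its
    cofactor are units; x is a root of one of the two, and minimality applies. *)
Lemma exists_irreducible (F : {poly int}) (x : K) : F \is monic ->
  root (map_poly intr F) x ->
  exists f : {poly int}, [/\ f \is monic,
    irreducible_poly (map_poly intr f : {poly rat}) & root (map_poly intr f) x].
Proof.
move=> F_monic Fx.
pose P n := `[< exists f : {poly int},
  [/\ f \is monic, size f = n & root (map_poly intr f) x] >].
have exP : exists n, P n by exists (size F); apply/asboolP; exists F.
case: (ex_minnP exP) => n /asboolP[f [f_monic fn fx]] n_min.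
have min_size (g : {poly int}) : lead_coef g \is a GRing.unit ->
    root (map_poly intr g) x -> (n <= size g)%N.
  (* A unit of [int] is its own inverse, so scaling by the leading coefficient makes [g] monic. *)
  move=> g_unit gx; apply: n_min; apply/asboolP; exists (lead_coef g *: g).
  have lg0 : lead_coef g != 0 by apply: contraTneq g_unit => ->; rewrite unitr0.
  split; last by rewrite map_polyZ rootZ // intr_eq0.
    rewrite monicE lead_coefZ -expr2.
    by move: g_unit; rewrite qualifE /= => /orP[] /eqP ->.
  by rewrite size_scale.
exists f; split=> //; split.
  rewrite size_map_intr ltnNge; apply/negP => /size1_polyC fE.
  move: fx f_monic; rewrite fE map_polyC rootC monicE lead_coefC intr_eq0.
  by move=> /eqP ->.
move=> q q_size qf; have [p1 [a a0 qE] [r fE]] := dvdpP_rat_int qf.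
have q_p1 : size q = size p1 by rewrite qE size_scale // size_map_intr.
have lead1 : lead_coef p1 * lead_coef r = 1 by rewrite -lead_coefM -fE (monicP f_monic).
have p1_unit : lead_coef p1 \is a GRing.unit.
  by apply/unitrP; exists (lead_coef r); rewrite mulrC lead1.
have r_unit : lead_coef r \is a GRing.unit.
  by apply/unitrP; exists (lead_coef p1); rewrite mulrC [_ * lead_coef p1]mulrC lead1.
have unit_neq0 (g : {poly int}) : lead_coef g \is a GRing.unit -> g != 0.
  by rewrite -lead_coef_eq0; apply: contraTneq => ->; rewrite unitr0.
have p10 := unit_neq0 _ p1_unit.
have r0 := unit_neq0 _ r_unit.
have size_f : size f = (size p1 + size r).-1 by rewrite fE size_mul.
move: fx; rewrite {1}fE rmorphM /= rootM => /orP[p1x|rx].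
  rewrite -dvdp_size_eqp // q_p1 size_map_intr eqn_leq fn min_size // andbT.
  by rewrite -fn size_f; move: r0; rewrite -size_poly_gt0; lia.
have := min_size _ r_unit rx; rewrite -fn size_f -q_p1.
by move: p10 q_size; rewrite -size_poly_gt0 -q_p1; lia.
Qed.

(** The reciprocal polynomial X^d f(1/X), with [d = (size f).-1]. *)
Definition reverse_poly (f : {poly int}) : {poly int} :=
  \poly_(i < size f) f`_(size f - i.+1).

Lemma horner_reverse_poly (f : {poly int}) (x : K) : x != 0 ->
  (map_poly intr (reverse_poly f)).[x] =
  x ^+ (size f).-1 * (map_poly intr f).[x^-1].
Proof.
move=> x0; rewrite /reverse_poly; set n := size f.
have -> : map_poly (intr : int -> K) (\poly_(i < n) f`_(n - i.+1)) =
    \poly_(i < n) (f`_(n - i.+1))%:~R.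
  by apply/polyP => i; rewrite coef_map /= !coef_poly; case: ifP.
rewrite horner_poly (horner_coef_wide _ (_ : size _ <= n)%N); last first.
  by rewrite size_map_intr.
rewrite mulr_sumr (reindex_inj rev_ord_inj) /=; apply: eq_bigr => i _.
rewrite coef_map /= mulrCA; congr (_ * _).
  by congr (f`_ _)%:~R; have := ltn_ord i; lia.
have -> : n.-1 = (n - i.+1 + i)%N by have := ltn_ord i; lia.
by rewrite exprD -mulrA -exprMn mulfV // expr1n mulr1.
Qed.
End MinimalPolynomial.

(** * A criterion for Pisot numbers *)

Section Pisot.
Variable R : realType.
Local Notation toC := (map_poly (intr : int -> R[i])).
Local Notation toR := (map_poly (intr : int -> R)).

Lemma toC_real (f : {poly int}) (x : R) :
  root (toC f) (real_complex R x) = root (toR f) x.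
Proof.
rewrite -(fmorph_root (real_complex R)) -map_poly_comp.
by congr (root _ _); apply: eq_map_poly => a /=; rewrite rmorph_int.
Qed.

(** On the unit circle the inverse is the complex conjugate, and the coefficients are real. *)
Lemma toC_conj (f : {poly int}) (z : R[i]) : normc z = 1 ->
  root (toC f) z -> root (toC f) z^-1.
Proof.
move=> z1; have z0 : z != 0.
  by apply/eqP => z0; move/eqP: z1; rewrite z0 normc0 eq_sym oner_eq0.
have -> : z^-1 = conjc z.
  apply: (mulfI z0); rewrite mulfV //; case: z z1 {z0} => u v /= uv.
  apply/eqP; rewrite eq_complex /=; apply/andP; split; apply/eqP; last ring.
  transitivity (u ^+ 2 + v ^+ 2); last ring.
  by rewrite -[_ + _]sqr_sqrtr ?uv ?expr1n // addr_ge0 ?sqr_ge0.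
rewrite -(fmorph_root (@conjc R)) -map_poly_comp.
by congr (root _ _); apply: eq_map_poly => a /=; rewrite rmorph_int.
Qed.

Lemma pisot_number_root (F : {poly int}) (x : R) : F \is monic -> 1 < x ->
  root (toR F) x ->
  (forall z, 1 < normc z -> root (toC F) z -> z = real_complex R x) ->
  (forall t, 0 < t < 1 -> ~~ root (toR F) t) ->
  pisot_number x.
Proof.
move=> F_monic x1 Fx F_outer F_inner; split=> //.
have x_gt0 : 0 < x by apply: lt_trans x1.
have x0 : x != 0 by rewrite gt_eqF.
have [f [f_monic f_irr fx]] := exists_irreducible F_monic Fx.
have f_min (K : numFieldType) (w : K) (g : {poly rat}) :
    root (map_poly intr f) w -> root (map_poly ratr g) w -> map_poly intr f %| g.
  by rewrite -map_ratr_intr; apply: irreducible_dvd.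
have fF : (map_poly intr f : {poly rat}) %| map_poly intr F.
  by apply: (f_min R x) => //; rewrite map_ratr_intr.
exists f; split.
  by split=> [||g]; [exact: monic_map | rewrite map_ratr_intr | exact: f_min].
split=> //.
- move=> n n0 fn; move: fx; rewrite fn => Phix.
  have : root (toR ('X^n - 1)) x.
    rewrite -prod_Cyclotomic // (big_rem n) /=; last first.
      by rewrite -dvdn_divisors.
    by rewrite rmorphM rootM Phix.
  rewrite rmorphB /= map_polyXn rmorph1 rootE !hornerE subr_eq0.
  by rewrite gt_eqF // exprn_egt1 // -lt0n.
- exists (real_complex R x); split.
    by rewrite toC_real fx normc_real // ltW.
  by move=> z [fz z1]; apply/esym/F_outer => //; exact: root_dvd fF fz.
move=> z fz; apply/eqP => z1.
have z0 : z != 0.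
  by apply/eqP => z0; move/eqP: z1; rewrite z0 normc0 eq_sym oner_eq0.
(* As z and 1/z are both roots of the irreducible [f], it divides its reciprocal polynomial; then
   1/x is a root of [f], hence of [F], inside (0, 1). *)
have f_rev : map_poly intr f %| map_poly (intr : int -> rat) (reverse_poly f).
  apply: (f_min R[i] z) => //; rewrite map_ratr_intr.
  apply/rootP; rewrite horner_reverse_poly //.
  by rewrite (rootP (toC_conj z1 fz)) mulr0.
have := root_dvd f_rev fx; rewrite rootE horner_reverse_poly //.
rewrite mulf_eq0 expf_eq0 (negPf x0) andbF /= -rootE => /(root_dvd fF).
by apply/negP/F_inner; rewrite invr_gt0 x_gt0 invf_lt1.
Qed.
End Pisot.

(** * Signs of F^(i)_(p,q) and its outer root *)

Lemma coxA_sum n : coxA n = \sum_(i < n.+1) 'X^i.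
Proof.
have X10 : 'X - 1 != 0 :> {poly int} by rewrite -[1]/(1%:P) polyXsubC_eq0.
by apply: (mulfI X10); rewrite coxA_geometric subrX1.
Qed.

Lemma coxA_horner1 n : (coxA n).[1] = n.+1%:R.
Proof.
rewrite coxA_sum horner_sum; under eq_bigr do rewrite hornerXn expr1n.
by rewrite sumr_const card_ord.
Qed.

Lemma coxA_ge1 (R : realType) n (t : R) : 0 <= t ->
  1 <= (map_poly intr (coxA n)).[t].
Proof.
move=> t0; rewrite coxA_sum rmorph_sum horner_sum big_ord_recl /=.
rewrite map_polyXn hornerXn expr0 lerDl sumr_ge0 // => i _.
by rewrite map_polyXn hornerXn exprn_ge0.
Qed.

(** The values at 1 are 1 - p q, -2 q and -4 for i = 0, 1, 2. In the excluded case F is X^2 - 1,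
    whose spectral radius 1 is not a Pisot number. *)
Lemma Fpoly_horner1 i p q : (i <= 2)%N -> admissible i 0 p -> admissible i 1 q ->
  ~ [/\ i = 0%N, p = 1%N & q = 1%N] -> (Fpoly i p q).[1] < 0.
Proof.
case: i => [|[|[|i]]] // _; rewrite /admissible /Fpoly /= => p_ge q_ge pq.
- rewrite hornerD hornerN hornerM hornerXn !coxA_horner1 expr1n -natrM.
  rewrite -!subSn // !subn1 /= subr_lt0 ltr1n.
  have [p1|p1] := eqVneq p 1%N; last by nia.
  have [q1|q1] := eqVneq q 1%N; last by nia.
  by case: pq.
- rewrite hornerD hornerN !hornerM hornerD hornerN hornerX hornerD !hornerXn.
  by rewrite !hornerC coxA_horner1 !expr1n subrr mulr0 sub0r oppr_lt0 mulr_gt0.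
rewrite hornerD hornerN !hornerM horner_exp !hornerD hornerN hornerX !hornerXn.
by rewrite !hornerC !expr1n subrr.
Qed.

Section FpolyRoots.
Variable R : realType.
Local Notation toC := (map_poly (intr : int -> R[i])).
Local Notation toR := (map_poly (intr : int -> R)).

(** On (0, 1) the subtracted product is at least 1, while the first term is below 1. *)
Lemma Fpoly_inner i p q (t : R) : (i <= 2)%N -> admissible i 0 p ->
  admissible i 1 q -> 0 < t < 1 -> ~~ root (toR (Fpoly i p q)) t.
Proof.
move=> i2 p_ge q_ge /andP[t0 t1]; rewrite rootE lt_eqF //.
have tX m : (0 < m)%N -> t ^+ m < 1 by move=> m0; rewrite exprn_ilt1 // ?ltW // -lt0n.
have tX0 m : 0 <= t ^+ m by rewrite exprn_ge0 // ltW.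
have A1 n := coxA_ge1 n (ltW t0).
case: i i2 p_ge q_ge => [|[|[|i]]] // _; rewrite /admissible /Fpoly /= => p_ge q_ge.
- rewrite rmorphB rmorphM /= map_polyXn hornerD hornerN hornerM hornerXn subr_lt0.
  apply: lt_le_trans (tX _ _) _; first lia.
  by rewrite -[leLHS]mulr1 ler_pM.
- rewrite rmorphB !rmorphM rmorphB rmorphD /= !map_polyXn map_polyX !rmorph1.
  rewrite hornerD hornerN !hornerM hornerD hornerN hornerX hornerD !hornerXn !hornerC.
  have := A1 (q - 1)%N; have := tX0 (p - 2)%N; have := tX0 (p + q - 2)%N.
  move: (t ^+ (p - 2)) (t ^+ (p + q - 2)) (toR _).[t] => u v w v0 u0 w1.
  by rewrite subr_lt0; nra.
rewrite rmorphB !rmorphM rmorphXn rmorphB !rmorphD /= !map_polyXn map_polyX !rmorph1.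
rewrite hornerD hornerN !hornerM horner_exp !hornerD hornerN hornerX !hornerXn !hornerC.
have := tX0 (p - 2)%N; have := tX0 (q - 2)%N.
have := tX0 (p + q - 4)%N; have : t ^+ (p + q - 4) < 1 by apply: tX; lia.
move: (t ^+ (p - 2)) (t ^+ (q - 2)) (t ^+ (p + q - 4)) => u v w w1 w0 v0 u0.
rewrite subr_lt0; apply: lt_le_trans (_ : 1 <= _); last by nra.
have : (t - 1) ^+ 2 < 1 by nra.
have := sqr_ge0 (t - 1); move: ((t - 1) ^+ 2) => s s0 s1; nra.
Qed.

(** F changes sign between 1 and 9, so it has a real root beyond 1; strict monotonicity of [sym_fun]
    makes it the only root outside the closed unit disc. *)
Lemma Fpoly_pisot i p q : (i <= 2)%N -> admissible i 0 p -> admissible i 1 q ->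
  ~ [/\ i = 0%N, p = 1%N & q = 1%N] -> pisot_number (rho R (Fpoly i p q)).
Proof.
move=> i2 p_ge q_ge pq; set F := Fpoly i p q.
have [F_monic F_size] : F \is monic /\ (1 < size F)%N by apply: Fpoly_monic.
have F1 : (toR F).[1] < 0.
  by rewrite -[1]/(1%:~R) horner_map ltrz0 Fpoly_horner1.
(* The eigenvalue variable is the square of the argument of [sym_fun], which is positive from 3
   on. *)
have F9 : 0 < (toR F).[3 ^+ 2].
  have x1 : 1 < 3 :> R by lra.
  have zN s : good_sign s -> forall j, (3 ^+ 2 : R) ^+ j.+1 != s%:~R.
    by move=> s_good; apply: sqr_exp_neq.
  have D_pos s j : good_sign s -> 0 < (3 ^+ 2 : R) ^+ j.+1 - s%:~R.
    by move=> s_good; rewrite subr_gt0 exp_gt_sign // exprn_egt1.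
  have three0 : 3 != 0 :> R by lra.
  have FE := Fpoly_horner i2 p_ge q_ge (expf_neq0 2 three0) (zN 1 isT) (zN (-1) isT).
  rewrite -(pmulr_rgt0 _ (_ : 0 < (3 ^+ 2 - 1) ^+ (2 - i) * 3 ^+ 2)).
    rewrite FE char_fun_sqr //; apply: mulr_gt0.
      by apply: mulr_gt0; apply: D_pos; exact: branch_sign_good.
    apply: mulr_gt0; first by lra.
    by apply: sym_fun_ge3; rewrite ?branch_sign_good.
  by apply: mulr_gt0; apply: exprn_gt0; lra.
have [x /andP[x_ge1 _] Fx] : exists2 x, 1 <= x <= 3 ^+ 2 & root (toR F) x.
  by apply: poly_ivt; rewrite ?(ltW F1) ?(ltW F9) //; lra.
have x1 : 1 < x.
  rewrite lt_neqAle x_ge1 andbT; apply: contraTneq Fx => <-.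
  by rewrite rootE lt_eqF.
have outer z : 1 < normc z -> root (toC F) z -> exists2 y : R, 1 < y &
    z = real_complex R (y ^+ 2) /\
    sym_fun (branch_index i 0 p) (branch_index i 1 q) (0, 0%N) y = 0.
  move=> z1 Fz; apply: outer_root_real; rewrite ?branch_sign_good //.
  exact/(Fpoly_root i2 p_ge q_ge z1).
have x_ge0 : 0 <= x by lra.
have [y y1 [/complexI xy fy]] : exists2 y : R, 1 < y &
    real_complex R x = real_complex R (y ^+ 2) /\
    sym_fun (branch_index i 0 p) (branch_index i 1 q) (0, 0%N) y = 0.
  by apply: outer; rewrite ?normc_real // toC_real.
have unique z : 1 < normc z -> root (toC F) z -> z = real_complex R x.
  move=> z1 Fz; have [w w1 [-> fw]] := outer z z1 Fz; rewrite xy.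
  have mono := @sym_fun_mono R (branch_index i 0 p) (branch_index i 1 q) (0, 0%N)
    (branch_sign_good i 0) (branch_sign_good i 1) isT.
  have [/(mono _ _ w1)|/(mono _ _ y1)|-> //] := ltgtP w y; by rewrite fw fy ltxx.
have -> : rho R F = x.
  apply/eqP; rewrite eq_le; apply/andP; split.
    apply: rho_le; first by exists (real_complex R x); rewrite toC_real.
    move=> z Fz; have [z1|z1] := leP (normc z) 1; first lra.
    by rewrite (unique z z1 Fz) normc_real.
  by rewrite -[leLHS]normc_real // normc_le_rho // toC_real.
apply: (pisot_number_root F_monic x1 Fx unique).
by move=> t; apply: Fpoly_inner.
Qed.
End FpolyRoots.

Theorem theorem2p3 (R : realType) :
  [/\ (* (1) *)
      forall i p q : nat, (i <= 2)%N -> admissible i 0 p -> admissible i 1 q ->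
        is_lim1 (fun r => rho R (coxS i p q r)) (rho R (Fpoly i p q)) /\
        (~ [/\ i = 0%N, p = 1%N & q = 1%N] -> pisot_number (rho R (Fpoly i p q))),
      (* (2) *)
      forall i q r : nat, (1 <= i <= 3)%N ->
        admissible i 1 q -> admissible i 2 r ->
        is_lim1 (fun p => rho R (coxS i p q r)) (rho R (Fpoly (i - 1) q r)),
      (* (3) *)
      forall i r : nat, (i <= 2)%N ->
        is_lim2 (fun p q => rho R (coxS i p q r))
                (rho R ('X^(r + 2) - 2 *: 'X^(r + 1) + 1)),
      (* (4) *)
      forall i p : nat, (1 <= i <= 3)%N -> (3 <= p)%N ->
        is_lim2 (fun q r => rho R (coxS i p q r))
                (rho R ('X^p - 2 *: 'X^(p - 1) - 1))
    & (* (5) *)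
      forall i : nat, (i <= 3)%N ->
        is_lim3 (fun p q r => rho R (coxS i p q r)) 2].
Proof.
split.
- by move=> i p q i2 p_ge q_ge; split; [exact: limit_r | exact: Fpoly_pisot].
- exact: limit_p.
- exact: limit_pq.
- exact: limit_qr.
- by move=> i _; exact: limit_pqr.
Qed.
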